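(* Let $\widehat{H}_{r,n}^{\mathcal{R}}:=\mathcal{R}\otimes_{\mathcal{A}}\widehat{H}_{r,n}$. Then there is an $\mathcal{R}$-algebra isomorphism $\widehat{Y}_{r,n}\xrightarrow{\sim}\widehat{H}_{r,n}^{\mathcal{R}}$. Moreover, the set $$\{X_1^{\alpha_1}\cdots X_n^{\alpha_n}1_\lambda g_w \mid \alpha_1,\dots,\alpha_n\in\mathbb{Z},\ \lambda\in\underline{\mathfrak{s}}_n,\ w\in\mathfrak{S}_n\}$$ is an $\mathcal{A}$-basis of $\widehat{H}_{r,n}$.
   Context: Let $r,n\ge 1$, $\zeta=e^{2\pi i/r}$, $q$ an indeterminate, $\mathcal{R}=\mathbb{Z}[\frac1r][q,q^{-1},\zeta]$ and $\mathcal{A}=\mathbb{Z}[q,q^{-1}]$. Let $s_i=(i,i+1)\in\mathfrak{S}_n$. The affine Yokonuma–Hecke algebra $\widehat{Y}_{r,n}$ is the $\mathcal{R}$-algebra generated by $t_1,\dots,t_n,h_1,\dots,h_{n-1},Y_1^{\pm1}$ with relations: $h_ih_j=h_jh_i$ for $|i-j|\ge2$; $h_ih_{i+1}h_i=h_{i+1}h_ih_{i+1}$; $t_it_j=t_jt_i$; $h_it_j=t_{s_i(j)}h_i$; $t_i^r=1$; $h_i^2=1+(q-q^{-1})e_ih_i$ where $e_i=\frac1r\sum_{s=0}^{r-1}t_i^st_{i+1}^{-s}$; $Y_1Y_1^{-1}=Y_1^{-1}Y_1=1$; $h_1Y_1h_1Y_1=Y_1h_1Y_1h_1$; $h_iY_1=Y_1h_i$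 for $2\le i\le n-1$; $t_jY_1=Y_1t_j$ for all $j$. Set $\zeta_k:=\zeta^{k-1}$ ($1\le k\le r$) and let $\underline{\mathfrak{s}}_n$ be the set of $n$-tuples of $r$-th roots of unity, with $\mathfrak{S}_n$ acting by permuting entries; for $\lambda\in\underline{\mathfrak{s}}_n$ let $W_\lambda=\{w\in\mathfrak{S}_n\mid w(\lambda)=\lambda\}$. $\widehat{H}_{r,n}$ is the $\mathcal{A}$-algebra generated by $g_1,\dots,g_{n-1}$, $1_\lambda$ ($\lambda\in\underline{\mathfrak{s}}_n$), $X_1^{\pm1}$ with relations: $g_ig_j=g_jg_i$ for $|i-j|\ge2$; $g_ig_{i+1}g_i=g_{i+1}g_ig_{i+1}$; $g_i1_\lambda=1_{s_i(\lambda)}g_i$; $\sum_{\lambda}1_\lambda=1$; $1_\lambda1_{\lambda'}=\delta_{\lambda,\lambda'}1_\lambda$; $g_i^2=1+(q-q^{-1})\sum_{\lambda:\,s_i\in W_\lambda}g_i1_\lambda$; $X_1X_1^{-1}=X_1^{-1}X_1=1$; $g_1X_1g_1X_1=X_1g_1X_1g_1$; $g_iX_1=X_1g_i$ for $2\le i\le n-1$; $X_11_\lambda=1_\lambda X_1$. Define $X_{i+1}:=g_iX_ig_i$ for $1\le i\le n-1$, and for $w\in\mathfrak{S}_n$ with reduced expression $w=s_{i_1}\cdots s_{i_m}$ set $g_w:=g_{i_1}\cdots g_{i_m}$ (independent of the reduced expression). *)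

(* Defs.v *)
From HB Require Import structures.
From mathcomp Require Import all_boot all_order all_algebra all_fingroup all_field.
From Stdlib Require Import ClassicalEpsilon.
Set Implicit Arguments.
Unset Strict Implicit.
Unset Printing Implicit Defensive.
Import GRing.Theory.
Local Open Scope ring_scope.

Definition Kq : fieldType := {fraction {poly algC}}.
Definition qK : Kq := FracField.tofrac ('X : {poly algC}).
Definition cK (z : algC) : Kq := FracField.tofrac (z%:P).

Definition is_ring_hom (R S : nzRingType) (f : R -> S) : Prop :=
  [/\ f 1 = 1, forall x y, f (x + y) = f x + f y & forall x y, f (x * y) = f x * f y].

Definition is_alg_hom (R : nzRingType) (U V : algType R) (f : U -> V) : Prop :=
  is_ring_hom f /\ forall (a : R) (x : U), f (a *: x) = a *: f x.

Definition is_semialg_hom (A R : nzRingType) (phi : A -> R)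
  (U : algType A) (V : algType R) (f : U -> V) : Prop :=
  is_ring_hom f /\ forall (a : A) (x : U), f (a *: x) = phi a *: f x.

Definition subring_gen (K : nzRingType) (S : K -> Prop) (x : K) : Prop :=
  forall P : K -> Prop, P 0 -> P 1 ->
    (forall a b, P a -> P b -> P (a - b)) ->
    (forall a b, P a -> P b -> P (a * b)) ->
    (forall a, S a -> P a) -> P x.

Definition is_basis (A : nzRingType) (M : lmodType A) (I : eqType) (b : I -> M) : Prop :=
  (forall x : M, exists (s : seq I) (c : I -> A), x = \sum_(i <- s) c i *: b i) /\
  (forall (s : seq I) (c : I -> A), uniq s ->
     \sum_(i <- s) c i *: b i = 0 -> forall i, i \in s -> c i = 0).

Definition sw (i j : nat) : nat :=
  if j == i then i.+1 else if j == i.+1 then i else j.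

(* s_i = (i, i+1) as a permutation of 'I_n (0-based ordinals i-1 and i) *)
Definition sT (n i : nat) : 'S_n :=
  match (insub i.-1 : option 'I_n), (insub i : option 'I_n) with
  | Some a, Some b => tperm a b
  | _, _ => 1%g
  end.

(* lambda in s_n: n-tuples of r-th roots of unity, zeta_k = zeta^(k-1) encoded
   by the exponent k-1 : 'I_r *)
Definition lab (n r : nat) := {ffun 'I_n -> 'I_r}.
Definition pact (n r : nat) (w : 'S_n) (l : lab n r) : lab n r :=
  [ffun j => l ((w^-1)%g j)].
Definition inW (n r : nat) (l : lab n r) (w : 'S_n) : bool := pact w l == l.

Definition is_expr (n : nat) (w : 'S_n) (s : seq nat) : bool :=
  all (fun i => (0 < i < n)%N) s && ((\prod_(i <- s) sT n i)%g == w).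
Definition reduced (n : nat) (w : 'S_n) (s : seq nat) : Prop :=
  is_expr w s /\ forall s', is_expr w s' -> (size s <= size s')%N.

Record Yrels (R : nzRingType) (r n : nat) (q qi invr : R) (Y : algType R)
  (t h : nat -> Y) (Y1 Y1i : Y) : Prop := {
  Yr_hcomm : forall i j, (1 <= i <= n.-1)%N -> (1 <= j <= n.-1)%N ->
      ((i.+2 <= j) || (j.+2 <= i))%N -> h i * h j = h j * h i;
  Yr_braid : forall i, (1 <= i)%N -> (i.+1 <= n.-1)%N ->
      h i * h i.+1 * h i = h i.+1 * h i * h i.+1;
  Yr_tcomm : forall i j, (1 <= i <= n)%N -> (1 <= j <= n)%N -> t i * t j = t j * t i;
  Yr_ht : forall i j, (1 <= i <= n.-1)%N -> (1 <= j <= n)%N -> h i * t j = t (sw i j) * h i;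
  Yr_tr : forall i, (1 <= i <= n)%N -> t i ^+ r = 1;
  (* e_i = 1/r sum_s t_i^s t_{i+1}^{-s}, with t_{i+1}^{-s} = t_{i+1}^{r-s} *)
  Yr_quad : forall i, (1 <= i <= n.-1)%N ->
      h i ^+ 2 = 1 + (q - qi) *: ((invr *: \sum_(s < r) (t i ^+ s * t i.+1 ^+ (r - s))) * h i);
  Yr_Yinv : Y1 * Y1i = 1 /\ Y1i * Y1 = 1;
  Yr_hY : (1 <= n.-1)%N -> h 1 * Y1 * h 1 * Y1 = Y1 * h 1 * Y1 * h 1;
  Yr_hYcomm : forall i, (2 <= i <= n.-1)%N -> h i * Y1 = Y1 * h i;
  Yr_tY : forall j, (1 <= j <= n)%N -> t j * Y1 = Y1 * t j
}.

Definition Y_agree (R : nzRingType) (n : nat) (Y B : algType R) (f : Y -> B)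
  (t h : nat -> Y) (Y1 Y1i : Y) (t' h' : nat -> B) (Y1' Y1i' : B) : Prop :=
  [/\ forall i, (1 <= i <= n)%N -> f (t i) = t' i,
      forall i, (1 <= i <= n.-1)%N -> f (h i) = h' i,
      f Y1 = Y1' & f Y1i = Y1i'].

Definition Y_presented (R : nzRingType) (r n : nat) (q qi invr : R) (Y : algType R)
  (t h : nat -> Y) (Y1 Y1i : Y) : Prop :=
  Yrels r n q qi invr t h Y1 Y1i /\
  forall (B : algType R) (t' h' : nat -> B) (Y1' Y1i' : B),
    Yrels r n q qi invr t' h' Y1' Y1i' ->
    (exists f : Y -> B, is_alg_hom f /\ Y_agree n f t h Y1 Y1i t' h' Y1' Y1i') /\
    (forall f1 f2 : Y -> B, is_alg_hom f1 -> is_alg_hom f2 ->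
       Y_agree n f1 t h Y1 Y1i t' h' Y1' Y1i' ->
       Y_agree n f2 t h Y1 Y1i t' h' Y1' Y1i' -> f1 =1 f2).

Record Hrels (A : nzRingType) (r n : nat) (q qi : A) (H : algType A)
  (g : nat -> H) (one : lab n r -> H) (X1 X1i : H) : Prop := {
  Hr_gcomm : forall i j, (1 <= i <= n.-1)%N -> (1 <= j <= n.-1)%N ->
      ((i.+2 <= j) || (j.+2 <= i))%N -> g i * g j = g j * g i;
  Hr_braid : forall i, (1 <= i)%N -> (i.+1 <= n.-1)%N ->
      g i * g i.+1 * g i = g i.+1 * g i * g i.+1;
  Hr_g1 : forall i l, (1 <= i <= n.-1)%N -> g i * one l = one (pact (sT n i) l) * g i;
  Hr_sum1 : \sum_(l : lab n r) one l = 1;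
  Hr_idem : forall l l', one l * one l' = if l == l' then one l else 0;
  Hr_quad : forall i, (1 <= i <= n.-1)%N ->
      g i ^+ 2 = 1 + (q - qi) *: \sum_(l : lab n r | inW l (sT n i)) (g i * one l);
  Hr_Xinv : X1 * X1i = 1 /\ X1i * X1 = 1;
  Hr_gX : (1 <= n.-1)%N -> g 1 * X1 * g 1 * X1 = X1 * g 1 * X1 * g 1;
  Hr_gXcomm : forall i, (2 <= i <= n.-1)%N -> g i * X1 = X1 * g i;
  Hr_X1 : forall l, X1 * one l = one l * X1
}.

Definition H_agree (A : nzRingType) (r n : nat) (H B : algType A) (f : H -> B)
  (g : nat -> H) (one : lab n r -> H) (X1 X1i : H)
  (g' : nat -> B) (one' : lab n r -> B) (X1' X1i' : B) : Prop :=
  [/\ forall i, (1 <= i <= n.-1)%N -> f (g i) = g' i,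
      forall l, f (one l) = one' l,
      f X1 = X1' & f X1i = X1i'].

Definition H_presented (A : nzRingType) (r n : nat) (q qi : A) (H : algType A)
  (g : nat -> H) (one : lab n r -> H) (X1 X1i : H) : Prop :=
  Hrels q qi g one X1 X1i /\
  forall (B : algType A) (g' : nat -> B) (one' : lab n r -> B) (X1' X1i' : B),
    Hrels q qi g' one' X1' X1i' ->
    (exists f : H -> B, is_alg_hom f /\ H_agree f g one X1 X1i g' one' X1' X1i') /\
    (forall f1 f2 : H -> B, is_alg_hom f1 -> is_alg_hom f2 ->
       H_agree f1 g one X1 X1i g' one' X1' X1i' ->
       H_agree f2 g one X1 X1i g' one' X1' X1i' -> f1 =1 f2).

Fixpoint Xs (H : nzRingType) (g : nat -> H) (X1 : H) (i : nat) : H :=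
  match i with
  | 0 => X1
  | j.+1 => if j is 0 then X1 else g j * Xs g X1 j * g j
  end.

Definition uinv (H : nzRingType) (x : H) : H :=
  epsilon (inhabits (0 : H)) (fun y => x * y = 1 /\ y * x = 1).

Definition zpow (H : nzRingType) (x : H) (a : int) : H :=
  match a with
  | Posz k => x ^+ k
  | Negz k => uinv x ^+ k.+1
  end.

(* the element X_1^{a_1} ... X_n^{a_n} 1_lambda g_w, g_w computed from the
   reduced expression red w *)
Definition Hbasis_elt (A : nzRingType) (r n : nat) (H : algType A)
  (g : nat -> H) (one : lab n r -> H) (X1 : H) (red : 'S_n -> seq nat)
  (idx : {ffun 'I_n -> int} * lab n r * 'S_n) : H :=
  let: (alpha, l, w) := idx in
  (\prod_(i < n) zpow (Xs g X1 i.+1) (alpha i)) * one l * \prod_(k <- red w) g k.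

Definition base_change (A R : nzRingType) (phi : A -> R) (H : algType A)
  (HR : algType R) (iota : H -> HR) : Prop :=
  is_semialg_hom phi iota /\
  forall (B : algType R) (f : H -> B), is_semialg_hom phi f ->
    (exists F : HR -> B, is_alg_hom F /\ forall x, F (iota x) = f x) /\
    (forall F1 F2 : HR -> B, is_alg_hom F1 -> is_alg_hom F2 ->
       (forall x, F1 (iota x) = f x) -> (forall x, F2 (iota x) = f x) -> F1 =1 F2).

(* Main.v *)
(** For the isomorphism, both algebras are controlled by the commutative algebra
    of functions on labels: [t_j] acts on the summand [1_lambda] by
    [zeta ^ lambda_j], and conversely [1_lambda] is the product over [j] of the
    spectral idempotents of [t_j].

    Spanning. The relations expressing [g_i X_j^(+-1)] through
    [X_k^(+-1) g_i] and [X_k^(+-1) e_i] show that the elements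
    [X^alpha 1_lambda g_v], [v] any word, span.  Words are brought to the normal
    form [B_1 B_2 ... B_(n-1)], where [B_j] is a descending run starting at [j]:
    a normal form times a generator is braid equivalent to a normal form, or the
    generator cancels.  There are [n!] normal forms, so they are in bijection with
    ['S_n], and every reduced word is braid equivalent to its normal form.

    Freeness. For a point [x] and a label [l0] let [v_u], [u] in ['S_n], be the
    basis of a representation in which [X_i] acts on [v_u] by [x_(u i)],
    [1_lambda] by [delta_(lambda, l0 o u)], and [g_i v_u] is a combination of [v_u]
    and [v_(s_i u)] (Young's seminormal form).  In [g_w v_1] only subwords of [w]
    occur, and the coefficient of [v_w] is nonzero, so in a linear relation a term
    with [w] of maximal length can be isolated.  Taking [x_i = z ^ (N ^ i)] with
    [z] transcendental and [N] large, distinct [alpha] give distinct powers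
    of [z]. *)
Require Import Defs.
From HB Require Import structures.
From mathcomp Require Import all_boot all_order all_algebra all_fingroup all_field.
From mathcomp Require Import zify ring.
From Stdlib Require Import ClassicalEpsilon.
Import GRing.Theory.
Local Open Scope ring_scope.
Set Implicit Arguments.
Unset Strict Implicit.
Unset Printing Implicit Defensive.

(** * Restriction of scalars and generation by the generators *)

(** The alias carries [hphi] so that the [A]-algebra instance can depend on it. It turns
    [R]-algebras into targets for the universal property of [H], which speaks of [A]-algebras. *)
Definition restr (A R : nzRingType) (phi : A -> R) (hphi : is_ring_hom phi)
  (B : algType R) : Type := B.

Section RestrictScalars.
Variables (A R : nzRingType) (phi : A -> R) (hphi : is_ring_hom phi).
Variable B : algType R.

HB.instance Definition _ := GRing.NzRing.on (restr hphi B).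

Definition restr_scale (a : A) (x : restr hphi B) : restr hphi B :=
  phi a *: (x : B).

Fact restr_scaleA a b v : restr_scale a (restr_scale b v) = restr_scale (a * b) v.
Proof. by rewrite /restr_scale scalerA; have [_ _ hM] := hphi; rewrite hM. Qed.
Fact restr_scale1 : left_id 1 restr_scale.
Proof. by move=> v; rewrite /restr_scale; have [h1 _ _] := hphi; rewrite h1; apply: scale1r. Qed.
Fact restr_scaleDr : right_distributive restr_scale +%R.
Proof. by move=> a u v; apply: (@scalerDr R B). Qed.
Fact restr_scaleDl v : {morph restr_scale^~ v : a b / a + b}.
Proof. by move=> a b; rewrite /restr_scale; have [_ hD _] := hphi; rewrite hD; apply: scalerDl. Qed.

HB.instance Definition _ := GRing.Zmodule_isLmodule.Build A (restr hphi B)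
  restr_scaleA restr_scale1 restr_scaleDr restr_scaleDl.

Fact restr_scaleAl (a : A) (u v : restr hphi B) : a *: (u * v) = (a *: u) * v.
Proof. exact: (@scalerAl R B). Qed.
HB.instance Definition _ :=
  GRing.Lmodule_isLalgebra.Build A (restr hphi B) restr_scaleAl.

Fact restr_scaleAr (a : A) (u v : restr hphi B) : a *: (u * v) = u * (a *: v).
Proof. exact: (@scalerAr R B). Qed.
HB.instance Definition _ :=
  GRing.Lalgebra_isAlgebra.Build A (restr hphi B) restr_scaleAr.

Lemma restr_scaleE (a : A) (x : restr hphi B) : a *: x = phi a *: (x : B).
Proof. by []. Qed.
End RestrictScalars.

Section ClassicalSubalgebra.
Variables (A : nzRingType) (H : algType A) (P : H -> Prop).

(** Subtypes are cut out by boolean predicates, so excluded middle is used to decide [P]. *)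
Definition classical_pred : pred H :=
  fun x => if excluded_middle_informative (P x) then true else false.

Lemma classical_predP x : reflect (P x) (classical_pred x).
Proof.
by rewrite /classical_pred; case: excluded_middle_informative => h; constructor.
Qed.

Lemma classical_subalg_closed :
  P 1 -> (forall x y, P x -> P y -> P (x - y)) -> (forall a x, P x -> P (a *: x)) ->
  (forall x y, P x -> P y -> P (x * y)) -> subalg_closed classical_pred.
Proof.
move=> P1 PB PZ PM; split; first by apply/classical_predP.
- move=> a u v /classical_predP Pu /classical_predP Pv; apply/classical_predP.
  by rewrite -[v]opprK; apply: (PB); [apply: PZ | rewrite -(sub0r v);
    apply: (PB) => //; rewrite -(subrr u); apply: PB].
- move=> u v /classical_predP Pu /classical_predP Pv; apply/classical_predP.
  exact: PM.
Qed.

Hypothesis Pclosed : subalg_closed classical_pred.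
HB.instance Definition _ := GRing.isSubalgClosed.Build A H classical_pred Pclosed.
Definition subalg_type of subalg_closed classical_pred := {x : H | classical_pred x}.
HB.instance Definition _ := Choice.on (subalg_type Pclosed).
HB.instance Definition _ := SubType.on (subalg_type Pclosed).
HB.instance Definition _ := [SubChoice_isSubAlgebra of subalg_type Pclosed by <:].

Lemma subalg_val_hom : is_alg_hom (\val : subalg_type Pclosed -> H).
Proof.
split; first split.
- by rewrite GRing.val1.
- by move=> x y; rewrite raddfD.
- by move=> x y; rewrite GRing.valM.
- by move=> a x; rewrite linearZ.
Qed.

End ClassicalSubalgebra.

(** The map [lift] is total, with value 0 outside [P], so that families of generators can be
    transported by plain composition. *)
Lemma exists_subalgebra (A : nzRingType) (H : algType A) (P : H -> Prop) :
  P 1 -> (forall x y, P x -> P y -> P (x - y)) -> (forall a x, P x -> P (a *: x)) ->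
  (forall x y, P x -> P y -> P (x * y)) ->
  exists (S : algType A) (v : S -> H) (lift : H -> S),
    [/\ is_alg_hom v, injective v, forall s, P (v s) & forall x, P x -> v (lift x) = x].
Proof.
move=> P1 PB PZ PM; have cl := classical_subalg_closed P1 PB PZ PM.
pose S : algType A := subalg_type cl.
exists S, ((\val : S -> H)), (fun y : H => insubd (0 : S) y); split.
- exact: subalg_val_hom.
- exact: val_inj.
- by move=> s; apply/classical_predP; apply: (valP s).
- by move=> y /classical_predP Py; rewrite [LHS]val_insubd Py.
Qed.

Lemma is_alg_hom_linear (A : nzRingType) (U V : algType A) (f : U -> V) :
  is_alg_hom f -> [/\ f 0 = 0, forall x y, f (x - y) = f x - f y &
    forall (I : Type) (s : seq I) (P : pred I) (F : I -> U),
      f (\sum_(i <- s | P i) F i) = \sum_(i <- s | P i) f (F i)].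
Proof.
move=> [[_ fD _] fZ].
have f0 : f 0 = 0 by rewrite -[X in f X](scale0r 0) fZ scale0r.
split=> // [x y|I s P F]; first by rewrite fD -scaleN1r fZ scaleN1r.
by elim/big_ind2: _ => // _ x _ y <- <-.
Qed.

(** The elements satisfying [P] form a subalgebra containing the generators, and the relations hold
    there, so the universal property maps [H] into it. Followed by the inclusion, this map is the
    identity by uniqueness, hence every element satisfies [P]. *)
Lemma H_presented_ind (A : nzRingType) (r n : nat) (q qi : A) (H : algType A)
  (g : nat -> H) (one : lab n r -> H) (X1 X1i : H) (P : H -> Prop) :
  H_presented q qi g one X1 X1i ->
  P 1 -> (forall x y, P x -> P y -> P (x - y)) -> (forall a x, P x -> P (a *: x)) ->
  (forall x y, P x -> P y -> P (x * y)) ->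
  (forall i, (1 <= i <= n.-1)%N -> P (g i)) -> (forall l, P (one l)) ->
  P X1 -> P X1i -> forall x, P x.
Proof.
move=> [rels univ] P1 PB PZ PM Pg Pone PX PXi x.
have [S [v [lift [vhom v_inj vP liftE]]]] := exists_subalgebra P1 PB PZ PM.
have [v0 _ vsum] := is_alg_hom_linear vhom.
have [[v1 vD vM] vZ] := vhom.
have [r1 r2 r3 r4 r5 r6 [r7 r7'] r8 r9 r10] := rels.
have relsS : Hrels q qi (lift \o g) (lift \o one) (lift X1) (lift X1i).
  split; rewrite /comp.
  - by move=> i j hi hj hij; apply: v_inj; rewrite 2!vM !liftE; try exact: Pg; exact: r1.
  - move=> i hi hj; apply: v_inj; rewrite 4!vM !liftE ?r2 //; apply: Pg; lia.
  - by move=> i l hi; apply: v_inj; rewrite 2!vM !liftE ?r3 //; apply: Pg.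
  - by apply: v_inj; rewrite vsum v1 -r4; apply: eq_bigr => l _; apply: liftE.
  - by move=> l l'; apply: v_inj; rewrite vM !liftE // r5; case: eqP; rewrite ?liftE.
  - move=> i hi; apply: v_inj; rewrite expr2 vM vD vZ vsum v1.
    rewrite -expr2 liftE ?r6 //; last exact: Pg.
    by congr (_ + _ *: _); apply: eq_bigr => l _; rewrite vM !liftE //; apply: Pg.
  - by split; apply: v_inj; rewrite vM v1 !liftE.
  - by move=> hi; apply: v_inj; rewrite 6!vM !liftE ?r8 //; apply: Pg; lia.
  - by move=> i hi; apply: v_inj; rewrite 2!vM !liftE ?r9 //; apply: Pg; lia.
  - by move=> l; apply: v_inj; rewrite 2!vM !liftE.
have [[f [[[f1 fD fM] fZ] [fg fone fX fXi]]] _] := univ _ _ _ _ _ relsS.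
have [_ uniq] := univ _ _ _ _ _ rels.
suff <- : v (f x) = x by apply: vP.
apply: (uniq (v \o f) id) => //.
- by split; [split=> [|u w|u w] /= | move=> a u /=]; rewrite ?f1 ?fD ?fM ?fZ ?v1 ?vD ?vM ?vZ.
- by split=> [i hi|l||] /=; rewrite ?fg ?fone ?fX ?fXi //= liftE //; apply: Pg.
Qed.

(** * Label-diagonal elements *)

Section SimpleTranspositions.
Variables (n r : nat).
Implicit Types (i : nat) (j : 'I_n) (l : lab n r).

Lemma sTK i : (sT n i * sT n i)%g = 1%g.
Proof.
by rewrite /sT; case: insub => [a|]; first case: insub => [b|];
  rewrite ?tperm2 ?mulg1.
Qed.

Lemma sTV i : (sT n i)^-1%g = sT n i.
Proof. by apply/eqP; rewrite eq_invg_mul sTK. Qed.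

Lemma sTT i j : sT n i (sT n i j) = j.
Proof. by rewrite -permM sTK perm1. Qed.

Lemma sT_val i j : (0 < i < n)%N ->
  val (sT n i j) = if val j == i.-1 then i else if val j == i then i.-1 else val j.
Proof.
move=> hi; have h1 : (i.-1 < n)%N by lia.
have h2 : (i < n)%N by lia.
rewrite /sT (insubT (fun k => k < n)%N h1) (insubT (fun k => k < n)%N h2) permE /=.
by rewrite -2!val_eqE /=; case: eqP => // _; case: eqP.
Qed.

Lemma sw_sT i j : (0 < i < n)%N -> sw i j.+1 = (sT n i j).+1.
Proof.
by move=> hi; rewrite /sw [nat_of_ord (sT n i j)](sT_val _ hi) /=; do !case: eqP; lia.
Qed.

Lemma pact_sTE i l j : pact (sT n i) l j = l (sT n i j).
Proof. by rewrite ffunE sTV. Qed.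

Lemma pact_sTT i : involutive (fun l => pact (sT n i) l).
Proof. by move=> l; apply/ffunP => j; rewrite !pact_sTE sTT. Qed.

Lemma inW_sT i l (a b : 'I_n) : (0 < i < n)%N -> val a = i.-1 -> val b = i ->
  inW l (sT n i) = (l a == l b).
Proof.
move=> hi ha hb.
have hab : sT n i a = b by apply: val_inj; rewrite sT_val // ha eqxx hb.
apply/eqP/eqP => [e|e]; first by rewrite -{1}e pact_sTE hab.
apply/ffunP => j; rewrite pact_sTE.
have [->|ja] := eqVneq j a; first by rewrite hab.
have [->|jb] := eqVneq j b; first by rewrite -hab sTT hab.
congr (l _); apply: val_inj; rewrite sT_val //.
by rewrite -ha val_eqE (negbTE ja) -{1}hb val_eqE (negbTE jb).
Qed.
End SimpleTranspositions.

Section Diagonal.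
Variables (R : comNzRingType) (r n : nat) (q qi : R) (H : algType R).
Variables (g : nat -> H) (one : lab n r -> H) (X1 X1i : H).
Hypothesis rels : Hrels q qi g one X1 X1i.

Definition diag (f : lab n r -> R) : H := \sum_l f l *: one l.

Lemma eq_diag f f' : f =1 f' -> diag f = diag f'.
Proof. by move=> e; apply: eq_bigr => l _; rewrite e. Qed.

Lemma diag_one f l : diag f * one l = f l *: one l.
Proof.
rewrite mulr_suml (bigD1 l) //= big1 ?addr0 => [|m /negbTE ml];
by rewrite -scalerAl (Hr_idem rels) ?eqxx // ml scaler0.
Qed.

Lemma one_diag f l : one l * diag f = f l *: one l.
Proof.
rewrite mulr_sumr (bigD1 l) //= big1 ?addr0 => [|m /negbTE ml];
by rewrite -scalerAr (Hr_idem rels) ?eqxx // eq_sym ml scaler0.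
Qed.

Lemma diagM f f' : diag f * diag f' = diag (fun l => f l * f' l).
Proof.
rewrite [X in _ * X]/diag mulr_sumr; apply: eq_bigr => l _.
by rewrite -scalerAr diag_one scalerA mulrC.
Qed.

Lemma diag1 : diag (fun=> 1) = 1.
Proof. by rewrite -(Hr_sum1 rels); apply: eq_bigr => l _; rewrite scale1r. Qed.

Lemma diag_delta l : diag (fun m => (m == l)%:R) = one l.
Proof.
rewrite /diag (bigD1 l) //= eqxx scale1r big1 ?addr0 // => m /negbTE ->.
by rewrite scale0r.
Qed.

Lemma diagX f k : diag f ^+ k = diag (fun l => f l ^+ k).
Proof. by elim: k => [|k IH]; rewrite ?diag1 // exprS IH diagM; apply: eq_diag => l; rewrite exprS. Qed.

Lemma diagZ a f : a *: diag f = diag (fun l => a * f l).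
Proof. by rewrite scaler_sumr; apply: eq_bigr => l _; rewrite scalerA. Qed.

Lemma diag_sum I (s : seq I) (F : I -> lab n r -> R) :
  \sum_(i <- s) diag (F i) = diag (fun l => \sum_(i <- s) F i l).
Proof. by rewrite exchange_big; apply: eq_bigr => l _; rewrite scaler_suml. Qed.

Lemma diag_prod I (s : seq I) (F : I -> lab n r -> R) :
  \prod_(i <- s) diag (F i) = diag (fun l => \prod_(i <- s) F i l).
Proof.
elim: s => [|i s IH].
  by rewrite big_nil -diag1; apply: eq_diag => l; rewrite big_nil.
by rewrite big_cons IH diagM; apply: eq_diag => l; rewrite big_cons.
Qed.

Lemma g_diag f i : (1 <= i <= n.-1)%N ->
  g i * diag f = diag (fun l => f (pact (sT n i) l)) * g i.
Proof.
move=> hi; rewrite mulr_sumr [in RHS]mulr_suml.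
rewrite [RHS](reindex_inj (inv_inj (@pact_sTT n r i))) /=; apply: eq_bigr => l _.
by rewrite -scalerAr (Hr_g1 rels) // scalerAl pact_sTT.
Qed.

Lemma X1_diag f : X1 * diag f = diag f * X1.
Proof.
rewrite mulr_sumr mulr_suml; apply: eq_bigr => l _.
by rewrite -scalerAr (Hr_X1 rels) scalerAl.
Qed.

(** Counterpart of the Yokonuma idempotent e_i; with it the quadratic relation takes the same shape
    in both algebras. *)
Definition e_ (i : nat) : H := diag (fun l => (inW l (sT n i))%:R).

Lemma g_e i : (1 <= i <= n.-1)%N -> g i * e_ i = e_ i * g i.
Proof.
move=> hi; rewrite g_diag //; congr (_ * _); apply: eq_diag => l.
by rewrite /inW pact_sTT eq_sym.
Qed.

Lemma g_quad i : (1 <= i <= n.-1)%N -> g i ^+ 2 = 1 + (q - qi) *: (e_ i * g i).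
Proof.
move=> hi; rewrite (Hr_quad rels) // -g_e // mulr_sumr big_mkcond /=.
congr (_ + _ *: _); apply: eq_bigr => l _.
by case: inW; rewrite ?scale1r // scale0r mulr0.
Qed.

End Diagonal.

(** * Spectral idempotents of an r-th root of unity *)

Section RootsOfUnity.
Variables (R : comNzRingType) (r : nat) (z invr : R).
Hypothesis r_gt0 : (0 < r)%N.
Hypothesis zr : z ^+ r = 1.
Hypothesis z_reg : forall m x, ~~ (r %| m)%N -> x * (z ^+ m - 1) = 0 -> x = 0.
Hypothesis invrE : invr * r%:R = 1.

Lemma rootX_modn m : z ^+ (m %% r) = z ^+ m.
Proof. by rewrite {2}(divn_eq m r) exprD mulnC exprM zr expr1n mul1r. Qed.

Lemma eq_rootX m m' : m = m' %[mod r] -> z ^+ m = z ^+ m'.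
Proof. by rewrite -(rootX_modn m) -(rootX_modn m') => ->. Qed.

(** If r divides m, all terms are 1. Otherwise the geometric sum times z^m - 1 is z^(rm) - 1 = 0,
    and regularity of z^m - 1 makes the sum vanish. *)
Lemma sum_rootX m : invr * (\sum_(s < r) z ^+ (s * m)) = (r %| m)%:R.
Proof.
have [dvd|ndvd] := boolP (r %| m)%N.
  rewrite (eq_bigr (fun=> 1)) => [|s _]; first by rewrite sumr_const card_ord.
  by rewrite -(expr0 z); apply: eq_rootX; rewrite mod0n; apply/eqP/dvdn_mull.
rewrite (z_reg ndvd (x := \sum_(s < r) _)) ?mulr0 //.
rewrite (eq_bigr (fun s : 'I_r => (z ^+ m) ^+ s)) => [|s _].
  by rewrite mulrC -subrX1 -exprM (@eq_rootX _ 0) ?subrr //; apply/eqP; rewrite eqn_mod_dvd // subn0 dvdn_mull.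
by rewrite -exprM mulnC.
Qed.

(** The exponent r - a stands for -a. Since 0 < r - a + b < 2r, divisibility by r means r - a + b =
    r. *)
Lemma sum_rootXB (a b : 'I_r) :
  invr * (\sum_(s < r) z ^+ (s * (r - a) + s * b)) = (a == b)%:R.
Proof.
rewrite (eq_bigr (fun s : 'I_r => z ^+ (s * (r - a + b)))) => [|s _]; last by rewrite mulnDr.
rewrite sum_rootX; congr (nat_of_bool _)%:R.
apply/idP/eqP => [/dvdnP [k hk]|->]; last by rewrite subnK // ltnW.
apply: val_inj => /=; have := ltn_ord a; have := ltn_ord b => hb ha.
have hk1 : (k = 1)%N by case: k hk => [|[|k]] //; nia.
by move: hk; rewrite hk1 mul1n; lia.
Qed.

Section Idempotents.
Variables (Y : algType R).

(** For t^r = 1 this discrete Fourier sum is the projector onto the eigenspace of [t] for z^k, with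
    r - k in place of -k. *)
Definition eigE (t : Y) (k : nat) : Y :=
  invr *: \sum_(s < r) z ^+ (s * (r - k)) *: t ^+ s.

Lemma eigE_comm (x t : Y) k : x * t = t * x -> x * eigE t k = eigE t k * x.
Proof.
move=> xt; rewrite -scalerAr -scalerAl; congr (_ *: _).
rewrite mulr_sumr mulr_suml; apply: eq_bigr => s _.
by rewrite -scalerAr -scalerAl; congr (_ *: _); apply: commrX.
Qed.

Lemma eigE_mul (t v : Y) (a b : 'I_r) : t * v = z ^+ b *: v ->
  eigE t a * v = (a == b)%:R *: v.
Proof.
move=> tv; rewrite -scalerAl mulr_suml -sum_rootXB -scalerA scaler_suml.
congr (_ *: _); apply: eq_bigr => s _.
rewrite -scalerAl exprD -scalerA; congr (_ *: _); rewrite mulnC exprM.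
by elim: (s : nat) => [|m IH]; rewrite ?mul1r ?scale1r // exprSr -mulrA tv -scalerAr IH scalerA -exprS.
Qed.

Lemma mul_eigE (t : Y) (k : 'I_r) : t ^+ r = 1 -> t * eigE t k = z ^+ k *: eigE t k.
Proof.
move=> tr; rewrite -scalerAr scalerA mulrC -scalerA; congr (_ *: _).
pose F s := z ^+ (s * (r - k)) *: t ^+ s.
have FS s : t * F s = z ^+ k *: F s.+1.
  rewrite /F -scalerAr -exprS scalerA -exprD; congr (_ *: _); apply: eq_rootX.
  by rewrite mulSn addnA subnKC ?modnDl // ltnW.
rewrite mulr_sumr (eq_bigr (fun s : 'I_r => z ^+ k *: F s.+1)) => [|s _]; last exact: FS.
(* Multiplication by [t] has shifted the terms by one. After adding [F 0] both sides are the sum of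
   [F] from 0 to r, because [F r = F 0]. *)
rewrite -scaler_sumr; congr (_ *: _); apply: (@addIr _ (F 0)).
have e1 : \sum_(i < r.+1) F i = F 0 + \sum_(i < r) F i.+1 by rewrite big_ord_recl.
rewrite addrC -e1 big_ord_recr; congr (_ + _).
rewrite /F mul0n expr0 tr (@eq_rootX _ 0) //.
by rewrite mod0n modnMr.
Qed.

Lemma sum_eigE (t : Y) : \sum_(k < r) eigE t k = 1.
Proof.
rewrite -scaler_sumr exchange_big /= scaler_sumr.
rewrite (bigD1 (Ordinal r_gt0)) //= [X in _ + X]big1 ?addr0 => [|s s0].
  rewrite -scaler_suml scalerA (eq_bigr (fun k : 'I_r => z ^+ (k * 0))) => [|k _].
    by rewrite sum_rootX dvdn0 scale1r.
  by rewrite mul0n muln0.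
rewrite -scaler_suml scalerA.
rewrite (eq_bigr (fun k : 'I_r => z ^+ (k * (r - s)))) => [|k _].
  by rewrite sum_rootX gtnNdvd ?scale0r //; move: s0 (ltn_ord s); rewrite -val_eqE /=; lia.
(* The exponents s(r - k) and k(r - s) agree modulo r; adding sk to both removes the truncated
   subtractions. *)
apply: eq_rootX; apply/eqP; have := ltn_ord k; have := ltn_ord s => hs hk.
rewrite -(eqn_modDr (s * k)).
have -> : (s * (r - k) + s * k = s * r)%N by nia.
have -> : (k * (r - s) + s * k = k * r)%N by nia.
by rewrite !modnMl.
Qed.

End Idempotents.
End RootsOfUnity.

(** * Translating each set of relations into the other *)

Section YokonumaComparison.
Variables (R : comNzRingType) (r n : nat) (z invr q qi : R).
Hypothesis r_gt0 : (0 < r)%N.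
Hypothesis zr : z ^+ r = 1.
Hypothesis z_reg : forall m x, ~~ (r %| m)%N -> x * (z ^+ m - 1) = 0 -> x = 0.
Hypothesis invrE : invr * r%:R = 1.

(** The generators [t j] are numbered from 1 and the entries of a label from 0; this reads a label
    with the numbering of the generators. *)
Definition labv (l : lab n r) (j : nat) : nat :=
  if insub j.-1 is Some i then l i else 0%N.

Lemma labvS l (i : 'I_n) : labv l i.+1 = l i.
Proof. by rewrite /labv /= valK. Qed.

Lemma sum_rootXB' (a b : 'I_r) :
  invr * (\sum_(s < r) (z ^+ a) ^+ s * (z ^+ b) ^+ (r - s)) = (a == b)%:R.
Proof.
rewrite eq_sym -(sum_rootXB r_gt0 zr z_reg invrE); congr (_ * _); apply: eq_bigr => s _.
rewrite -!exprM -exprD; apply: (eq_rootX zr); apply/eqP.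
have [ha hb hs] := And3 (ltn_ord a) (ltn_ord b) (ltn_ord s).
rewrite -(eqn_modDr (s * b)).
have -> : (s * (r - b) + s * a + s * b = s * a + s * r)%N by nia.
have -> : (a * s + b * (r - s) + s * b = s * a + b * r)%N by nia.
by rewrite -modnDmr modnMl -[X in _ == X]modnDmr modnMl.
Qed.

Section Forward.
Variables (H : algType R) (g : nat -> H) (one : lab n r -> H) (X1 X1i : H).
Hypothesis rels : Hrels q qi g one X1 X1i.

Definition tD (j : nat) : H := diag one (fun l => z ^+ labv l j).

Lemma Yrels_of_Hrels : Yrels r n q qi invr tD g X1 X1i.
Proof.
split; try by case: rels.
- by move=> i j _ _; rewrite !(diagM rels); apply: eq_diag => l; rewrite mulrC.
- move=> i [//|j] hi hj; have hj' : (j < n)%N by lia.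
  rewrite /tD (g_diag rels) //; congr (_ * _); apply: eq_diag => l.
  by rewrite (sw_sT (Ordinal hj')) ?labvS ?(labvS _ (Ordinal hj')) ?pact_sTE //; lia.
- move=> i hi; rewrite (diagX rels) -(diag1 rels); apply: eq_diag => l.
  by rewrite -exprM mulnC exprM zr expr1n.
- move=> i hi; rewrite (g_quad rels) //; congr (1 + _ *: (_ * _)).
  rewrite /tD; under [in RHS]eq_bigr do rewrite !(diagX rels) (diagM rels).
  rewrite diag_sum diagZ; apply: eq_diag => l.
  have h1 : (i.-1 < n)%N by lia.
  have h2 : (i < n)%N by lia.
  rewrite (@inW_sT _ _ _ _ (Ordinal h1) (Ordinal h2)) //; last by lia.
  have -> : labv l i = l (Ordinal h1) by rewrite -labvS /= prednK //; case/andP: hi.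
  by rewrite (labvS l (Ordinal h2)) sum_rootXB'.
- by move=> j hj; rewrite /tD (X1_diag rels).
Qed.

(** Fourier inversion makes the i-th factor the diagonal element of the indicator of [l i = m i];
    the product of these indicators is that of [l = m]. *)
Lemma tD_idem (l : lab n r) : \prod_(i < n) eigE r z invr (tD i.+1) (l i) = one l.
Proof.
rewrite (eq_bigr (fun i : 'I_n => diag one (fun m => (l i == m i)%:R))) => [|i _].
  rewrite (diag_prod rels) -(diag_delta one l); apply: eq_diag => m.
  have [->|ml] := eqVneq m l; first by rewrite big1 // => i _; rewrite eqxx.
  have [i li] : exists i, l i != m i.
    apply/existsP; rewrite -negb_forall; apply: contra ml => /forallP e.
    by apply/eqP/ffunP => i; rewrite (eqP (e i)).
  by rewrite (bigD1 i) //= (negbTE li) mul0r.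
rewrite /eigE /tD; under eq_bigr do rewrite (diagX rels) diagZ.
rewrite diag_sum diagZ; apply: eq_diag => m.
rewrite -(sum_rootXB r_gt0 zr z_reg invrE); congr (_ * _); apply: eq_bigr => s _.
by rewrite labvS -exprM exprD [(s * m i)%N]mulnC.
Qed.
End Forward.

Section Backward.
Variables (Y : algType R) (t h : nat -> Y) (Y1 Y1i : Y).
Hypothesis rels : Yrels r n q qi invr t h Y1 Y1i.

Definition oneY (l : lab n r) : Y := \prod_(i < n) eigE r z invr (t i.+1) (l i).

Lemma eigE_t (i j : 'I_n) k : eigE r z invr (t j.+1) k * t i.+1 = t i.+1 * eigE r z invr (t j.+1) k.
Proof. by rewrite [RHS]eigE_comm // (Yr_tcomm rels) ?ltn_ord. Qed.

Lemma t_oneY (i : 'I_n) (l : lab n r) : t i.+1 * oneY l = z ^+ l i *: oneY l.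
Proof.
rewrite /oneY; have := mem_index_enum i.
elim: (index_enum _) => [|j s IH]; rewrite ?in_nil // inE big_cons.
have [<- _|ij /= /IH e] := eqVneq i j.
  by rewrite mulrA (mul_eigE invr zr) -?scalerAl // (Yr_tr rels) ?ltn_ord.
by rewrite mulrA -eigE_t -mulrA e scalerAr.
Qed.

(** The reindexing [k] allows for the permuted products that arise when [h i] is moved past the
    idempotents. *)
Lemma prod_eigE_oneY (s : seq 'I_n) (k : 'I_n -> 'I_n) (f : 'I_n -> 'I_r) m :
  (\prod_(i <- s) eigE r z invr (t (k i).+1) (f i)) * oneY m =
  (all (fun i => f i == m (k i)) s)%:R *: oneY m.
Proof.
elim: s => [|i s IH]; first by rewrite big_nil mul1r scale1r.
rewrite big_cons -mulrA IH -scalerAr.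
rewrite (eigE_mul r_gt0 zr z_reg invrE (f i) (t_oneY (k i) m)) scalerA /=.
by case: eqP => _; rewrite ?mulr1 ?mulr0.
Qed.

Lemma sum_oneY : \sum_l oneY l = 1.
Proof.
rewrite -(bigA_distr_bigA (fun (i : 'I_n) (k : 'I_r) => eigE r z invr (t i.+1) k)).
by rewrite big1 // => i _; apply: sum_eigE.
Qed.

(** As the [oneY l] sum to 1, two elements may be compared after multiplication by each [oneY l], on
    which the [t j] act by scalars. *)
Lemma oneY_ext x y : (forall l, x * oneY l = y * oneY l) -> x = y.
Proof.
move=> e; rewrite -[x]mulr1 -[y]mulr1 -sum_oneY !mulr_sumr; exact: eq_bigr.
Qed.

Lemma all_enum_eq (l m : lab n r) : all (fun i => l i == m i) (index_enum 'I_n) = (l == m).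
Proof.
apply/allP/eqP => [e|-> i _ //]; apply/ffunP => i; apply/eqP/e; exact: mem_index_enum.
Qed.

Lemma oneYM (l m : lab n r) : oneY l * oneY m = if l == m then oneY l else 0.
Proof.
rewrite {1}/oneY (prod_eigE_oneY _ id) all_enum_eq.
by case: eqP => [->|_]; rewrite ?scale1r ?scale0r.
Qed.

Lemma h_eigE i (j : 'I_n) k : (1 <= i <= n.-1)%N ->
  h i * eigE r z invr (t j.+1) k = eigE r z invr (t (sT n i j).+1) k * h i.
Proof.
move=> hi; rewrite /eigE -scalerAr -scalerAl mulr_sumr mulr_suml.
congr (_ *: _); apply: eq_bigr => s _; rewrite -scalerAr -scalerAl; congr (_ *: _).
elim: (s : nat) => [|m IH]; first by rewrite mulr1 mul1r.
rewrite !exprSr mulrA IH -!mulrA (Yr_ht rels) ?ltn_ord //.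
by rewrite sw_sT //; lia.
Qed.

(** Moving [h i] through the product applies s_i to the indices of the [t j]. The permuted product
    is recognised as the idempotent of the permuted label by testing it on every [oneY m]. *)
Lemma h_oneY i l : (1 <= i <= n.-1)%N -> h i * oneY l = oneY (pact (sT n i) l) * h i.
Proof.
move=> hi; transitivity ((\prod_(j < n) eigE r z invr (t (sT n i j).+1) (l j)) * h i).
  rewrite /oneY; elim: (index_enum _) => [|j s IH]; first by rewrite !big_nil mulr1 mul1r.
  by rewrite !big_cons mulrA h_eigE // -!mulrA IH.
congr (_ * _); apply: oneY_ext => m; rewrite prod_eigE_oneY (prod_eigE_oneY _ id).
congr ((nat_of_bool _)%:R *: _); rewrite all_enum_eq.
apply/allP/eqP => [e|<- j _]; last by rewrite pact_sTE sTT.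
apply/ffunP => j; rewrite pact_sTE -{2}(sTT i j); apply/eqP/e; exact: mem_index_enum.
Qed.

Lemma Hrels_of_Yrels : Hrels q qi h oneY Y1 Y1i.
Proof.
split; try by case: rels.
- by move=> i l hi; apply: h_oneY.
- exact: sum_oneY.
- exact: oneYM.
- move=> i hi; rewrite (Yr_quad rels) //; congr (_ + _ *: _).
  transitivity (\sum_(l | inW l (sT n i)) oneY l * h i); last first.
    by apply: eq_bigr => l /eqP sl; rewrite h_oneY // sl.
  (* It remains to see that e_i is the sum of the [oneY l] with s_i in W_l: on [oneY m] both act by
     1 if m takes equal values at i and i+1, and by 0 otherwise. *)
  rewrite -mulr_suml; congr (_ * _); apply: oneY_ext => m.
  have h1 : (i.-1 < n)%N by lia.
  have h2 : (i < n)%N by lia.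
  have t1 : t i * oneY m = z ^+ m (Ordinal h1) *: oneY m.
    by rewrite -t_oneY /= prednK //; case/andP: hi.
  have tX k a (j : nat) : t j * oneY m = a *: oneY m -> t j ^+ k * oneY m = a ^+ k *: oneY m.
    by move=> e; elim: k => [|k IH]; rewrite ?mul1r ?scale1r // exprSr -mulrA e -scalerAr IH scalerA -exprS.
  rewrite -scalerAl !mulr_suml.
  under eq_bigr => s _ do rewrite -mulrA (tX _ _ _ (t_oneY (Ordinal h2) m)) -scalerAr (tX _ _ _ t1) scalerA mulrC.
  rewrite -scaler_suml scalerA sum_rootXB' big_mkcond (bigD1 m) //= big1 => [|l /negbTE lm].
    rewrite addr0 (@inW_sT _ _ _ _ (Ordinal h1) (Ordinal h2)) //; last by lia.
    by rewrite oneYM eqxx; case: eqP; rewrite ?scale1r ?scale0r.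
  by case: ifP; rewrite // oneYM lm.
- move=> l; rewrite /oneY; elim: (index_enum _) => [|j s IH]; first by rewrite !big_nil mulr1 mul1r.
  rewrite !big_cons mulrA eigE_comm -?mulrA ?IH //.
  by rewrite (Yr_tY rels) // ltn_ord.
Qed.

Lemma sum_oneY_t (i : 'I_n) : \sum_(l : lab n r) z ^+ l i *: oneY l = t i.+1.
Proof.
by rewrite -[RHS]mulr1 -sum_oneY mulr_sumr; apply: eq_bigr => l _; rewrite t_oneY.
Qed.
End Backward.
End YokonumaComparison.

(** * Change of scalars and the isomorphism *)

Lemma is_ring_hom_sub (R S : nzRingType) (f : R -> S) :
  is_ring_hom f -> f 0 = 0 /\ forall x y, f (x - y) = f x - f y.
Proof.
move=> [_ fD _]; have fB x y : f (x - y) = f x - f y.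
  by apply: (@addIr _ (f y)); rewrite -fD !subrK.
by split=> //; rewrite -(subrr 0) fB subrr.
Qed.

Lemma Hrels_semialg (A R : nzRingType) (phi : A -> R) (r n : nat) (q qi : A)
  (U : algType A) (V : algType R) (f : U -> V) (g : nat -> U) (one : lab n r -> U) (X1 X1i : U) :
  is_ring_hom phi -> is_semialg_hom phi f -> Hrels q qi g one X1 X1i ->
  Hrels (phi q) (phi qi) (f \o g) (f \o one) (f X1) (f X1i).
Proof.
move=> hphi [fhom fZ] [r1 r2 r3 r4 r5 r6 [r7 r7'] r8 r9 r10].
have [_ phiB] := is_ring_hom_sub hphi; have [f0 _] := is_ring_hom_sub fhom.
have [f1 fD fM] := fhom.
have fsum I (s : seq I) (P : pred I) F :
  f (\sum_(i <- s | P i) F i) = \sum_(i <- s | P i) f (F i).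
  by elim/big_rec2: _ => // i x y _ <-; rewrite fD.
split; rewrite /comp.
- by move=> i j *; rewrite -2!fM r1.
- by move=> i *; rewrite -4!fM r2.
- by move=> i l *; rewrite -2!fM r3.
- by rewrite -fsum r4.
- by move=> l l'; rewrite -fM r5; case: eqP.
- move=> i hi; rewrite expr2 -fM -expr2 r6 // fD f1 fZ phiB fsum.
  by congr (_ + _ *: _); apply: eq_bigr => l _; rewrite fM.
- by rewrite -2!fM r7 r7'.
- by move=> *; rewrite -6!fM r8.
- by move=> *; rewrite -2!fM r9.
- by move=> *; rewrite -2!fM r10.
Qed.

Lemma Hrels_restr (A R : nzRingType) (phi : A -> R) (hphi : is_ring_hom phi)
  (r n : nat) (q qi : A) (V : algType R) (g : nat -> V) (one : lab n r -> V) (X1 X1i : V) :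
  Hrels (phi q) (phi qi) g one X1 X1i ->
  @Hrels A r n q qi (restr hphi V) g one X1 X1i.
Proof.
move=> [r1 r2 r3 r4 r5 r6 r7 r8 r9 r10]; split=> //.
by have [_ phiB] := is_ring_hom_sub hphi; move=> i /r6; rewrite -phiB.
Qed.

Lemma is_alg_hom_comp (R : nzRingType) (U V W : algType R) (f : U -> V) (f' : V -> W) :
  is_alg_hom f -> is_alg_hom f' -> is_alg_hom (f' \o f).
Proof.
move=> [[f1 fD fM] fZ] [[f1' fD' fM'] fZ'].
by split; first split; move=> * /=; rewrite ?f1 ?fD ?fM ?fZ.
Qed.

Lemma is_semialg_hom_comp (A R : nzRingType) (phi : A -> R) (U : algType A)
  (V W : algType R) (f : U -> V) (f' : V -> W) :
  is_semialg_hom phi f -> is_alg_hom f' -> is_semialg_hom phi (f' \o f).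
Proof.
move=> [[f1 fD fM] fZ] [[f1' fD' fM'] fZ'].
by split; first split; move=> * /=; rewrite ?f1 ?fD ?fM ?fZ.
Qed.

(** The map [f] comes from the presentation of [Y]. Its inverse [G] comes from the presentation of
    [H], used with restricted scalars, followed by base change. Both composites are identities by
    the uniqueness clauses. *)
Lemma affine_yokonuma_iso (A R : comNzRingType) (phi : A -> R) (r n : nat)
  (z invr : R) (q qi : A) (Y HR : algType R) (t h : nat -> Y) (Y1 Y1i : Y)
  (H : algType A) (g : nat -> H) (one : lab n r -> H) (X1 X1i : H) (iota : H -> HR) :
  (0 < r)%N -> z ^+ r = 1 ->
  (forall m x, ~~ (r %| m)%N -> x * (z ^+ m - 1) = 0 -> x = 0) ->
  invr * r%:R = 1 -> is_ring_hom phi ->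
  Y_presented r n (phi q) (phi qi) invr t h Y1 Y1i ->
  H_presented q qi g one X1 X1i -> base_change phi iota ->
  exists f : Y -> HR, is_alg_hom f /\ bijective f.
Proof.
move=> r_gt0 zr z_reg invrE hphi [relsY univY] [relsH univH] [iota_hom univHR].
have relsHR := Hrels_semialg hphi iota_hom relsH.
have relsYF := Yrels_of_Hrels r_gt0 zr z_reg invrE relsHR.
have relsHB := Hrels_of_Yrels r_gt0 zr z_reg invrE relsY.
have [[f [fhom [ft fh fY fYi]]] _] := univY _ _ _ _ _ relsYF.
have [[b [bhom [bg bone bX bXi]]] _] := univH _ _ _ _ _ (Hrels_restr hphi relsHB).
have [[G [Ghom Gi]] _] := univHR Y b bhom.
have [[f1 fD fM] fZ] := fhom.
have [[G1 GD GM] GZ] := Ghom.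
have [_ _ Gsum] := is_alg_hom_linear Ghom.
have [_ _ fsum] := is_alg_hom_linear fhom.
exists f; split=> //; exists G.
- have [_ uniq] := univY _ _ _ _ _ relsY.
  apply: (uniq (G \o f) id) => //; first exact: is_alg_hom_comp.
  split=> [[//|i] hi|i hi||] /=.
  + have hi' : (i < n)%N by [].
    rewrite ft // /tD /diag Gsum.
    rewrite -(sum_oneY_t r_gt0 zr z_reg invrE relsY (Ordinal hi')).
    by apply: eq_bigr => l _; rewrite GZ Gi bone (labvS _ (Ordinal hi')).
  + by rewrite fh //= Gi bg.
  + by rewrite fY Gi bX.
  + by rewrite fYi Gi bXi.
- have [_ uniq] := univHR HR iota iota_hom.
  (* Maps out of [HR] are determined by their composites with [iota], and these are compared on the
     generators of [H]. *)
  apply: (uniq (f \o G) id) => //; first exact: is_alg_hom_comp.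
  move=> x /=; rewrite Gi.
  have [_ uniqH] := univH _ _ _ _ _ (Hrels_restr hphi relsHR).
  apply: (uniqH (f \o b) iota) => //; first exact: (is_semialg_hom_comp (V := Y) (f' := f) bhom).
  split=> [i hi|l||] /=; rewrite ?bg ?bone ?bX ?bXi // ?fh //.
  (* Only the idempotents remain: [f] carries the spectral idempotents of [t] to those of [tD],
     whose product is the image of [one l]. *)
  have fprod (s : seq 'I_n) F : f (\prod_(i <- s) F i) = \prod_(i <- s) f (F i).
    by elim/big_rec2: _ => // i x' y _ <-; rewrite fM.
  rewrite fprod -[RHS](tD_idem r_gt0 zr z_reg invrE relsHR).
  apply: eq_bigr => i _; rewrite /eigE fZ fsum; congr (_ *: (_ : HR)); apply: eq_bigr => s _.
  rewrite fZ; congr (_ *: (_ : HR)); elim: (s : nat) => [//|k IH].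
  by rewrite !exprS fM IH ft ?ltn_ord.
Qed.

(** * Normal forms of words modulo braid relations *)

Section BraidWords.
Variable n : nat.
Implicit Types (u v w c : seq nat) (i j m : nat).

Definition in_range i := (0 < i < n)%N.

Inductive braid_eq : seq nat -> seq nat -> Prop :=
| beq_refl v : braid_eq v v
| beq_sym v w : braid_eq v w -> braid_eq w v
| beq_trans u v w : braid_eq u v -> braid_eq v w -> braid_eq u w
| beq_comm u v i j : in_range i -> in_range j -> ((i.+2 <= j) || (j.+2 <= i))%N ->
    braid_eq (u ++ [:: i; j] ++ v) (u ++ [:: j; i] ++ v)
| beq_braid u v i : in_range i -> in_range i.+1 ->
    braid_eq (u ++ [:: i; i.+1; i] ++ v) (u ++ [:: i.+1; i; i.+1] ++ v).

Lemma beq_cat u v w w' : braid_eq w w' -> braid_eq (u ++ w ++ v) (u ++ w' ++ v).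
Proof.
elim=> {w w'} [w|w w' _ h|w1 w2 w3 _ h1 _ h2|u' v' i j hi hj hij|u' v' i hi hi'].
- exact: beq_refl.
- exact: beq_sym.
- exact: beq_trans h1 h2.
- by rewrite -!catA !(catA u u'); apply: beq_comm.
- by rewrite -!catA !(catA u u'); apply: beq_braid.
Qed.

Lemma beq_catl u w w' : braid_eq w w' -> braid_eq (u ++ w) (u ++ w').
Proof. by move=> /(beq_cat u [::]); rewrite !cats0. Qed.

Lemma beq_catr v w w' : braid_eq w w' -> braid_eq (w ++ v) (w' ++ v).
Proof. exact: (@beq_cat [::]). Qed.

Lemma beq_size v w : braid_eq v w -> size v = size w.
Proof.
elim=> {v w} // [u v w _ -> _ -> //|u v i j *|u v i *]; by rewrite !size_cat.
Qed.

Lemma beq_prod (T : Type) (idx : T) (op : Monoid.law idx) (F : nat -> T) v w :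
  (forall i j, in_range i -> in_range j -> ((i.+2 <= j) || (j.+2 <= i))%N ->
     op (F i) (F j) = op (F j) (F i)) ->
  (forall i, in_range i -> in_range i.+1 ->
     op (op (F i) (F i.+1)) (F i) = op (op (F i.+1) (F i)) (F i.+1)) ->
  braid_eq v w -> \big[op/idx]_(i <- v) F i = \big[op/idx]_(i <- w) F i.
Proof.
move=> hc hb; elim=> {v w} // [u v w _ -> _ -> //|u v i j hi hj hij|u v i hi hi'].
  by rewrite !big_cat !big_cons !big_nil !Monoid.mulm1 hc.
have e : op (F i) (op (F i.+1) (F i)) = op (F i.+1) (op (F i) (F i.+1)).
  have opA x y z : op x (op y z) = op (op x y) z by exact: Monoid.mulmA.
  by rewrite !opA hb.
by rewrite !big_cat !big_cons !big_nil !Monoid.mulm1 e.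
Qed.

Lemma beq_move w i : in_range i -> all in_range w ->
  all (fun a => ((a.+2 <= i) || (i.+2 <= a))%N) w -> braid_eq (w ++ [:: i]) (i :: w).
Proof.
move=> hi; elim: w => [|a w IH] /=; first by move=> *; apply: beq_refl.
move=> /andP [ha hw] /andP [hai hwi]; apply: beq_trans (beq_catl [:: a] (IH hw hwi)) _.
exact: (@beq_comm [::]).
Qed.

(** For m from 0 to j these words represent the right cosets of S_j in S_(j+1) by elements of
    minimal length. *)
Fixpoint blk j m := if m is m'.+1 then j :: blk j.-1 m' else [::].

Lemma blkS j m : (m < j)%N -> blk j m.+1 = rcons (blk j m) (j - m)%N.
Proof.
elim: m j => [|m IH] j hm; first by rewrite subn0.
rewrite -[LHS]/(j :: blk j.-1 m.+1) IH; last by lia.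
by congr (_ :: rcons _ _); lia.
Qed.

Lemma mem_blk j m a : (m <= j)%N -> (a \in blk j m) = (j - m < a <= j)%N.
Proof.
elim: m j => [|m IH] j hm; first by rewrite in_nil; lia.
by rewrite [blk _ _]/= in_cons IH; lia.
Qed.

Lemma blk_range j m : (m <= j < n)%N -> all in_range (blk j m).
Proof. by move=> hm; apply/allP => a; rewrite mem_blk /in_range; lia. Qed.

(** The letter i moves left past all letters below i-1, the braid relation turns i, i-1, i into i-1,
    i, i-1, and the leading i-1 moves left past all letters above i. *)
Lemma blk_braid j m i : (j - m < i.-1)%N -> (i <= j < n)%N -> (m <= j)%N ->
  braid_eq (blk j m ++ [:: i]) (i.-1 :: blk j m).
Proof.
elim: m j => [|m IH] j hm hi hmj; first by lia.
have [ij|ij] := ltnP i j.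
  rewrite [blk _ _]/=; apply: (beq_trans (beq_catl [:: j] (IH j.-1 _ _ _))); try lia.
  by apply: (@beq_comm [::]); rewrite /in_range; lia.
have {}ij : i = j by lia.
subst i; case: m IH hm hmj => [|m] _ hm hmj; first by lia.
rewrite [blk _ _]/=; apply: (beq_trans (beq_catl [:: j; j.-1] (@beq_move (blk j.-2 m) j _ _ _))).
- by rewrite /in_range; lia.
- by apply: blk_range; lia.
- by apply/allP => a; rewrite mem_blk; lia.
have := @beq_braid [::] (blk j.-2 m) j.-1; rewrite prednK; last by lia.
by move=> h; apply: beq_sym; apply: h; rewrite /in_range; lia.
Qed.

Fixpoint nfs j : seq (seq nat) :=
  if j is j'.+1 then allpairs (fun c m => c ++ blk j m) (nfs j') (iota 0 j.+1) else [:: [::]].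

Lemma size_nfs j : size (nfs j) = (j.+1)`!.
Proof. by elim: j => // j IH; rewrite size_allpairs IH size_iota mulnC -factS. Qed.

Lemma mem_nfsS j c : reflect (exists c' m, [/\ c' \in nfs j, (m <= j.+1)%N & c = c' ++ blk j.+1 m])
  (c \in nfs j.+1).
Proof.
apply: (iffP allpairsP) => [[[c' m] [h1 h2 ->]]|[c' [m [h1 h2 ->]]]].
  by exists c', m; split=> //; move: h2; rewrite mem_iota /=; lia.
by exists (c', m); split=> //; rewrite mem_iota /=; lia.
Qed.

Lemma nfs_range j c : (j < n)%N -> c \in nfs j -> all in_range c.
Proof.
elim: j c => [|j IH] c hj; first by rewrite inE => /eqP ->.
case/mem_nfsS => c' [m [hc hm ->]]; rewrite all_cat IH //; last by lia.
by apply: blk_range; lia.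
Qed.

(** The last run ends in j+2-m. The next lower letter extends the run, and the last letter itself
    shortens it, which is the second alternative. A still lower letter commutes with the run, and a
    higher one passes it as i-1; both then meet the shorter normal form [c0], where induction
    applies. *)
Lemma nfs_step j c i : (j < n)%N -> c \in nfs j -> (0 < i <= j)%N ->
  (exists2 c', c' \in nfs j & braid_eq (c ++ [:: i]) c') \/
  (exists2 c', c' \in nfs j & braid_eq c (c' ++ [:: i])).
Proof.
elim: j c i => [|j IH] c i hj; first by lia.
case/mem_nfsS => c0 [m [hc0 hm ->]] hi.
have slide i' : (0 < i' <= j)%N -> braid_eq (blk j.+1 m ++ [:: i]) (i' :: blk j.+1 m) ->
  (exists2 c', c' \in nfs j.+1 & braid_eq ((c0 ++ blk j.+1 m) ++ [:: i]) c') \/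
  (exists2 c', c' \in nfs j.+1 & braid_eq (c0 ++ blk j.+1 m) (c' ++ [:: i])).
  move=> hi' hb; case: (IH c0 i' _ hc0 hi'); first by lia.
    move=> [c' hc' e]; left; exists (c' ++ blk j.+1 m); first by apply/mem_nfsS; exists c', m.
    rewrite -catA; apply: beq_trans (beq_catl _ hb) _.
    by rewrite -cat1s catA; apply: beq_catr.
  move=> [c' hc' e]; right; exists (c' ++ blk j.+1 m); first by apply/mem_nfsS; exists c', m.
  rewrite -catA; apply: beq_trans (beq_catr _ e) _.
  by rewrite -catA; apply/beq_catl/beq_sym.
have [i0|im] := eqVneq i (j.+1 - m)%N.
  left; exists (c0 ++ blk j.+1 m.+1).
    by apply/mem_nfsS; exists c0, m.+1; split=> //; lia.
  by rewrite blkS -?cats1 ?catA ?i0; [exact: beq_refl | lia].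
have [ik|ik] := eqVneq i (j.+2 - m)%N.
  case: m hm im ik {slide} => [|m] hm im ik; first by lia.
  right; exists (c0 ++ blk j.+1 m); first by apply/mem_nfsS; exists c0, m; split=> //; lia.
  by rewrite blkS -?cats1 -?catA ?ik ?subSS; [exact: beq_refl | lia].
have [lt|gt] := ltnP i (j.+1 - m)%N.
  apply: (slide i); first by lia.
  apply: beq_move; first by rewrite /in_range; lia.
    by apply: blk_range; lia.
  by apply/allP => a; rewrite mem_blk; lia.
apply: (slide i.-1); first by lia.
by apply: blk_braid; lia.
Qed.

Lemma sT_comm i j : in_range i -> in_range j -> ((i.+2 <= j) || (j.+2 <= i))%N ->
  (sT n i * sT n j = sT n j * sT n i)%g.
Proof.
move=> hi hj hij; apply/permP => k; rewrite !permM; apply: val_inj.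
rewrite !sT_val //; move: (val k) hi hj => {k} x; rewrite /in_range => hi hj.
by do !case: eqP; lia.
Qed.

Lemma sT_braid i : in_range i -> in_range i.+1 ->
  (sT n i * sT n i.+1 * sT n i = sT n i.+1 * sT n i * sT n i.+1)%g.
Proof.
move=> hi hj; apply/permP => k; rewrite !permM; apply: val_inj.
rewrite !sT_val //; move: (val k) hi hj => {k} x; rewrite /in_range => hi hj.
by do !case: eqP; lia.
Qed.

Definition wprod v : 'S_n := (\prod_(i <- v) sT n i)%g.

Lemma beq_wprod v w : braid_eq v w -> wprod v = wprod w.
Proof. by apply: beq_prod; [exact: sT_comm | exact: sT_braid]. Qed.

(** Letters are read one at a time; in the second alternative of [nfs_step] two equal letters meet
    and cancel in the symmetric group. *)
Lemma nfs_or_shorter v : (0 < n)%N -> all in_range v ->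
  (exists2 c, c \in nfs n.-1 & braid_eq v c) \/
  (exists v', [/\ all in_range v', wprod v' = wprod v & (size v' < size v)%N]).
Proof.
move=> n_gt0; elim/last_ind: v => [_|v i IH].
  left; exists [::]; last exact: beq_refl.
  by elim: n.-1 => // j IH; apply/mem_nfsS; exists [::], 0%N; split.
rewrite all_rcons => /andP [hi hv]; rewrite -cats1.
case: (IH hv) => [[c hc e]|[v' [hv' pv' sv']]]; last first.
  right; exists (v' ++ [:: i]); rewrite all_cat hv' /= hi !size_cat ltn_add2r; split=> //.
  by rewrite /wprod !big_cat; congr (_ * _)%g.
case: (@nfs_step n.-1 c i _ hc); [lia | move: hi; rewrite /in_range; lia | |].
  by case=> c' hc' e'; left; exists c' => //; apply: beq_trans (beq_catr _ e) e'.
case=> c' hc' e'; right; exists c'; split; first by apply: nfs_range hc'; lia.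
  rewrite (beq_wprod (beq_catr [:: i] (beq_trans e e'))) /wprod !big_cat !big_seq1.
  by rewrite /= -mulgA sTK mulg1.
by rewrite size_cat (beq_size e) (beq_size e') size_cat /=; lia.
Qed.

Lemma reduced_nfs (w : 'S_n) v : (0 < n)%N -> reduced w v ->
  exists c, [/\ c \in nfs n.-1, wprod c = w & braid_eq v c].
Proof.
move=> n_gt0 [/andP [hv /eqP pv] vmin].
case: (nfs_or_shorter n_gt0 hv) => [[c hc e]|[v' [hv' pv' sv']]].
  by exists c; split=> //; rewrite -(beq_wprod e).
have := vmin v'; rewrite /is_expr hv' -pv -/(wprod v) -pv' eqxx => /(_ isT); lia.
Qed.

(* There are n! normal forms and they exhaust 'S_n. *)
Lemma nfs_uniq : (0 < n)%N -> (forall w : 'S_n, exists v, reduced w v) ->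
  {in nfs n.-1 &, injective wprod}.
Proof.
move=> n_gt0 hred.
have sz : size (map wprod (nfs n.-1)) = #|'S_n|.
  by rewrite size_map size_nfs prednK // card_Sn.
have un : uniq (map wprod (nfs n.-1)).
  apply: (leq_size_uniq (enum_uniq 'S_n)); last by rewrite sz cardE.
  move=> w _; have [v hv] := hred w; have [c [hc <- _]] := reduced_nfs n_gt0 hv.
  exact: map_f.
move=> c c' hc hc' e.
have := nth_uniq 1%g _ _ un.
rewrite size_map => /(_ (index c (nfs n.-1)) (index c' (nfs n.-1))).
rewrite !index_mem hc hc' => /(_ isT isT).
rewrite !(nth_map [::]) ?index_mem // !nth_index // e eqxx => /esym/eqP ei.
by rewrite -(nth_index [::] hc) ei nth_index.
Qed.

(** This yields Matsumoto's theorem: all reduced words of a permutation are braid equivalent, being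
    equivalent to its only normal form. *)
Lemma reduced_braid_nfs (w : 'S_n) v c : (0 < n)%N ->
  (forall w : 'S_n, exists v, reduced w v) ->
  reduced w v -> c \in nfs n.-1 -> wprod c = w -> braid_eq v c.
Proof.
move=> n_gt0 hred hv hc pc; have [c' [hc' pc' e]] := reduced_nfs n_gt0 hv.
by rewrite (nfs_uniq n_gt0 hred hc hc') // pc pc'.
Qed.
End BraidWords.

(** * Spanning *)

Lemma comm_invl (R : nzRingType) (x x' y : R) :
  x * x' = 1 -> x' * x = 1 -> x * y = y * x -> x' * y = y * x'.
Proof.
move=> xx' x'x xy; rewrite -[LHS]mulr1 -xx' mulrA -(mulrA x' y x) -xy.
by rewrite (mulrA x' x) x'x mul1r.
Qed.

(** Two-sided inverses are unique, so the one chosen by [epsilon] may be replaced by any explicit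
    one. *)
Lemma uinvE (R : nzRingType) (x x' : R) : x * x' = 1 -> x' * x = 1 -> uinv x = x'.
Proof.
move=> xx' x'x.
have [h1 h2] : x * uinv x = 1 /\ uinv x * x = 1.
  by apply: (epsilon_spec (inhabits (0 : R)) (fun y => x * y = 1 /\ y * x = 1)); exists x'.
by rewrite -[LHS]mul1r -x'x -mulrA h1 mulr1.
Qed.

Section ZPow.
Variables (R : nzRingType) (x x' : R).
Hypotheses (xx' : x * x' = 1) (x'x : x' * x = 1).

Lemma zpowD1 a : zpow x a * x = zpow x (a + 1).
Proof.
case: a => [k|[|k]].
- by rewrite /= -exprSr addn1.
- by rewrite /= (uinvE xx' x'x) expr1.
- have -> : Negz k.+1 + 1 = Negz k by rewrite !NegzE; lia.
  by rewrite /= (uinvE xx' x'x) exprSr -mulrA x'x mulr1.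
Qed.

Lemma zpowB1 a : zpow x a * x' = zpow x (a - 1).
Proof.
have {1}-> : a = a - 1 + 1 by lia.
by rewrite -zpowD1 -mulrA xx' mulr1.
Qed.

Lemma zpow_comm y a : x * y = y * x -> zpow x a * y = y * zpow x a.
Proof.
move=> xy; have x'y := comm_invl xx' x'x xy.
case: a => k /=; rewrite ?(uinvE xx' x'x).
- exact/esym/commrX/esym.
- exact/esym/(@commrX _ y x' k.+1)/esym.
Qed.
End ZPow.

(** Used to absorb a factor X_j or its inverse into an ordered monomial: it commutes with every
    factor and changes the j-th one only. *)
Lemma prod_mulr_at (R : nzRingType) (I : eqType) (s : seq I) (F F' : I -> R) (j : I) (y : R) :
  uniq s -> j \in s -> (forall i, F i * y = y * F i) -> F j * y = F' j ->
  (forall i, i != j -> F i = F' i) ->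
  (\prod_(i <- s) F i) * y = \prod_(i <- s) F' i.
Proof.
move=> + + Fy Fj Fi.
elim: s => [//|i s IH] /= /andP [nis us]; rewrite in_cons !big_cons.
have [ji _|ji /= js] := eqVneq j i; last by rewrite -mulrA IH // Fi // eq_sym.
rewrite -mulrA; have -> : (\prod_(k <- s) F k) * y = y * \prod_(k <- s) F k.
  by elim: (s) => [|k u IHu]; rewrite ?big_nil ?mulr1 ?mul1r // big_cons -mulrA IHu !mulrA Fy.
rewrite mulrA -ji Fj; congr (_ * _); rewrite [LHS]big_seq [RHS]big_seq; apply: eq_bigr => k ks.
by apply: Fi; apply: contraNneq nis => kj; rewrite -ji -kj.
Qed.

Inductive lin (A : nzRingType) (M : lmodType A) (S : M -> Prop) : M -> Prop :=
| lin0 : lin S 0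
| linD x y : lin S x -> lin S y -> lin S (x + y)
| linZ a x : lin S x -> lin S (a *: x)
| lin_gen x : S x -> lin S x.

Lemma linB (A : nzRingType) (M : lmodType A) (S : M -> Prop) x y :
  lin S x -> lin S y -> lin S (x - y).
Proof. by move=> hx hy; rewrite -scaleN1r; apply: linD => //; apply: linZ. Qed.

Lemma lin_sum (A : nzRingType) (M : lmodType A) (S : M -> Prop) I (s : seq I) (F : I -> M) :
  (forall i, lin S (F i)) -> lin S (\sum_(i <- s) F i).
Proof. by move=> h; elim/big_ind: _ => // [|x y]; [apply: lin0 | apply: linD]. Qed.

Lemma lin_mulr (A : nzRingType) (M : algType A) (S S' : M -> Prop) y :
  (forall x, S x -> lin S' (x * y)) -> forall x, lin S x -> lin S' (x * y).
Proof.
move=> h x; elim=> {x} [|x x' _ hx _ hx'|a x _ hx|x hx].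
- by rewrite mul0r; apply: lin0.
- by rewrite mulrDl; apply: linD.
- by rewrite -scalerAl; apply: linZ.
- exact: h.
Qed.

Lemma lin_sub (A : nzRingType) (M : lmodType A) (S S' : M -> Prop) :
  (forall x, S x -> lin S' x) -> forall x, lin S x -> lin S' x.
Proof.
move=> h x; elim=> {x} [|x x' _ hx _ hx'|a x _ hx|x hx].
- exact: lin0.
- exact: linD.
- exact: linZ.
- exact: h.
Qed.

Lemma lin_family (A : nzRingType) (M : lmodType A) (I : eqType) (b : I -> M) x :
  lin (fun y => exists i, y = b i) x ->
  exists (s : seq I) (c : I -> A), x = \sum_(i <- s) c i *: b i.
Proof.
move=> hx.
have [p ->] : exists p : seq (A * I), x = \sum_(u <- p) u.1 *: b u.2.
  elim: hx => {x} [|x y _ [p ->] _ [p' ->]|a x _ [p ->]|x [i ->]].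
  - by exists [::]; rewrite big_nil.
  - by exists (p ++ p'); rewrite big_cat.
  - exists [seq (a * u.1, u.2) | u <- p]; rewrite big_map scaler_sumr.
    by apply: eq_bigr => u _; rewrite scalerA.
  - by exists [:: (1, i)]; rewrite big_seq1 scale1r.
(* The coefficient must be a function of the index, so terms with the same index are collected. *)
exists (undup (map snd p)), (fun i => \sum_(u <- p | u.2 == i) u.1).
under [RHS]eq_bigr do rewrite scaler_suml big_mkcond.
rewrite exchange_big /= [LHS]big_seq [RHS]big_seq; apply: eq_bigr => u up.
have um : u.2 \in undup (map snd p) by rewrite mem_undup map_f.
rewrite (bigD1_seq u.2) ?undup_uniq //= eqxx big1 ?addr0 // => i.
by rewrite eq_sym => /negbTE ->.
Qed.

(** * Bernstein relations and spanning monomials *)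

Section Bernstein.
Variables (A : comNzRingType) (r n : nat) (q qi : A) (H : algType A).
Variables (g : nat -> H) (one : lab n r -> H) (X1 X1i : H).
Hypothesis rels : Hrels q qi g one X1 X1i.
Let e := e_ one.
Let dq := q - qi.
Notation in_g i := (1 <= i <= n.-1)%N.
Notation in_X j := (1 <= j <= n)%N.

(** The quadratic relation says g_i (g_i - (q - q^-1) e_i) = 1, so this is the inverse of g_i.
    Running the recursion [Xs] on these inverses and [X1i] gives the inverses of the X_j. *)
Definition ginv (i : nat) : H := g i - dq *: e i.
Let X := Xs g X1.
Let Xi := Xs ginv X1i.

Lemma g_ginv i : in_g i -> g i * ginv i = 1.
Proof.
move=> hi; rewrite mulrBr -scalerAr (g_e rels) // -expr2 (g_quad rels) //.
by rewrite addrK.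
Qed.

Lemma ginv_g i : in_g i -> ginv i * g i = 1.
Proof.
move=> hi; rewrite mulrBl -scalerAl -expr2 (g_quad rels) //.
by rewrite addrK.
Qed.

Lemma XsS i : (0 < i)%N -> X i.+1 = g i * X i * g i.
Proof. by case: i. Qed.

Lemma XisS i : (0 < i)%N -> Xi i.+1 = ginv i * Xi i * ginv i.
Proof. by case: i. Qed.

Lemma X_Xi j : in_X j -> X j * Xi j = 1 /\ Xi j * X j = 1.
Proof.
elim: j => [//|[|j] IH] hj; first exact: (Hr_Xinv rels).
have [|h1 h2] := IH; first by lia.
have hg : in_g j.+1 by lia.
rewrite XsS // XisS //; split.
  by rewrite !mulrA -(mulrA _ (g _) (ginv _)) g_ginv // mulr1 -(mulrA _ (X _) (Xi _)) h1 mulr1 g_ginv.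
by rewrite !mulrA -(mulrA _ (ginv _) (g _)) ginv_g // mulr1 -(mulrA _ (Xi _) (X _)) h2 mulr1 ginv_g.
Qed.

Lemma X_diag f j : in_X j -> X j * diag one f = diag one f * X j.
Proof.
elim: j f => [//|[|j] IH] f hj; first exact: (X1_diag rels).
have hg : in_g j.+1 by lia.
rewrite XsS // -!mulrA (g_diag rels) // (mulrA (X _)) IH; last by lia.
rewrite !mulrA (g_diag rels) //; do 3!congr (_ * _).
by apply: eq_diag => l; rewrite pact_sTT.
Qed.

Lemma gX_lt i j : in_g i -> (0 < j < i)%N -> g i * X j = X j * g i.
Proof.
move=> hi; elim: j => [//|[|j] IH] hj.
  by apply: (Hr_gXcomm rels); lia.
have c : g i * g j.+1 = g j.+1 * g i by apply: (Hr_gcomm rels); lia.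
by rewrite XsS // !mulrA c -(mulrA _ (g i)) IH ?mulrA -?(mulrA _ (g i)) ?c ?mulrA //; lia.
Qed.

Lemma gX_gt i j : in_g i -> (i.+1 < j <= n)%N -> g i * X j = X j * g i.
Proof.
move=> hi; elim: j => [//|j IH] hj.
have [ij|ij] := ltnP i.+1 j.
  have c : g i * g j = g j * g i by apply: (Hr_gcomm rels); lia.
  rewrite XsS; last by lia.
  by rewrite !mulrA c -(mulrA _ (g i)) IH ?mulrA -?(mulrA _ (g i)) ?c ?mulrA //; lia.
(* Remaining case: X_(i+2) = g_(i+1) g_i X_i g_i g_(i+1). A braid relation lets g_i enter from the
   left as g_(i+1) next to X_i, with which it commutes; a second one brings it out on the right as
   g_i. *)
have hn : in_g i.+1 by lia.
have {ij hj IH} -> : j = i.+1 by lia.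
rewrite XsS // XsS; last by lia.
have b := Hr_braid rels.
have c : g i.+1 * X i = X i * g i.+1 by apply: gX_lt => //; lia.
have {}b : g i * g i.+1 * g i = g i.+1 * g i * g i.+1 by apply: b; lia.
transitivity (g i.+1 * g i * X i * (g i.+1 * g i * g i.+1)).
  by rewrite !mulrA b -(mulrA _ (g i.+1) (X i)) c !mulrA.
by rewrite -b !mulrA.
Qed.

Lemma gX_far i j : in_g i -> in_X j -> j != i -> j != i.+1 -> g i * X j = X j * g i.
Proof.
move=> hi hj ji ji1; have [lt|gt] := ltnP j i; first by apply: gX_lt => //; lia.
by apply: gX_gt => //; lia.
Qed.

(** For k < m, induction on k: g_k commutes with X_m when m > k+1, which reduces X_(k+1) to X_k. The
    case k = 1 is an induction on m that starts from the relation between g_1 and X_1. *)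
Lemma X_comm i j : in_X i -> in_X j -> X i * X j = X j * X i.
Proof.
suff hlt k m : (0 < k < m)%N -> (m <= n)%N -> X k * X m = X m * X k.
  move=> hi hj; have [lt|gt|-> //] := ltngtP i j; first by apply: hlt; lia.
  by rewrite (hlt j i) //; lia.
elim: k m => [//|[|k] IH] m hk hm.
  elim: m hk hm => [//|[//|m] IHm] hk hm.
  have hg : in_g m.+1 by lia.
  have [m0|m0] := posnP m.
    rewrite m0 (@XsS 1%N) // !mulrA; apply/esym/(Hr_gX rels); lia.
  have c : g m.+1 * X 1 = X 1 * g m.+1 by apply: (Hr_gXcomm rels); lia.
  rewrite (@XsS m.+1) // !mulrA -c -(mulrA (g m.+1) (X 1)) IHm; try lia.
  by rewrite !mulrA -(mulrA _ (X 1)) -c !mulrA.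
have hg : in_g k.+1 by lia.
have c : g k.+1 * X m = X m * g k.+1 by apply: gX_gt => //; lia.
rewrite (@XsS k.+1) // -!mulrA c (mulrA (X k.+1)) IH; try lia.
by rewrite !mulrA c.
Qed.

Lemma XXi_comm i j : in_X i -> in_X j -> X i * Xi j = Xi j * X i.
Proof.
move=> hi hj; have [h1 h2] := X_Xi hj.
by rewrite (comm_invl h1 h2 (X_comm hj hi)).
Qed.

Lemma Xi_diag f j : in_X j -> Xi j * diag one f = diag one f * Xi j.
Proof. by move=> hj; have [h1 h2] := X_Xi hj; apply: comm_invl h1 h2 (X_diag f hj). Qed.

Lemma gX_self i : in_g i -> g i * X i = X i.+1 * ginv i.
Proof. by move=> hi; rewrite XsS -?mulrA ?g_ginv ?mulr1 //; case/andP: hi. Qed.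

Lemma gX_next i : in_g i -> g i * X i.+1 = X i * g i + dq *: (X i.+1 * e i).
Proof.
move=> hi; have i_gt0 : (0 < i)%N by case/andP: hi.
have eX : e i * X i.+1 = X i.+1 * e i by rewrite X_diag //; lia.
rewrite -eX XsS // !mulrA -expr2 (g_quad rels) // !mulrDl mul1r.
by rewrite -!scalerAl ?mulrA.
Qed.

Lemma gXi_far i j : in_g i -> in_X j -> j != i -> j != i.+1 -> g i * Xi j = Xi j * g i.
Proof.
move=> hi hj ji ji1; have [h1 h2] := X_Xi hj.
by rewrite (comm_invl h1 h2 (esym (gX_far hi hj ji ji1))).
Qed.

Lemma gXi_next i : in_g i -> g i * Xi i.+1 = Xi i * ginv i.
Proof. by move=> hi; rewrite XisS ?mulrA ?g_ginv ?mul1r //; case/andP: hi. Qed.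

Lemma gXi_self i : in_g i -> g i * Xi i = Xi i.+1 * g i + dq *: (Xi i * e i).
Proof.
move=> hi; have i_gt0 : (0 < i)%N by case/andP: hi.
have eX : e i * Xi i = Xi i * e i by rewrite Xi_diag //; lia.
rewrite XisS // -(mulrA _ (ginv i) (g i)) ginv_g // mulr1 mulrBl -scalerAl eX.
by rewrite subrK.
Qed.

Definition Xm (alpha : {ffun 'I_n -> int}) : H := \prod_(i < n) zpow (X i.+1) (alpha i).

Let upd (alpha : {ffun 'I_n -> int}) (j : 'I_n) (d : int) : {ffun 'I_n -> int} :=
  [ffun i => if i == j then alpha i + d else alpha i].

Lemma Xm_mul alpha (j : 'I_n) : Xm alpha * X j.+1 = Xm (upd alpha j 1).
Proof.
have hX (i : 'I_n) : in_X i.+1 by rewrite /= ltn_ord.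
apply: (prod_mulr_at (j := j)); rewrite ?index_enum_uniq ?mem_index_enum //.
- by move=> i; have [h1 h2] := X_Xi (hX i); apply: (zpow_comm h1 h2); apply: X_comm.
- by have [h1 h2] := X_Xi (hX j); rewrite (zpowD1 h1 h2) ffunE eqxx.
- by move=> i /negbTE ij; rewrite ffunE ij.
Qed.

Lemma Xm_mulV alpha (j : 'I_n) : Xm alpha * Xi j.+1 = Xm (upd alpha j (-1)).
Proof.
have hX (i : 'I_n) : in_X i.+1 by rewrite /= ltn_ord.
apply: (prod_mulr_at (j := j)); rewrite ?index_enum_uniq ?mem_index_enum //.
- by move=> i; have [h1 h2] := X_Xi (hX i); apply: (zpow_comm h1 h2); apply: XXi_comm.
- by have [h1 h2] := X_Xi (hX j); rewrite (zpowB1 h1 h2) ffunE eqxx.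
- by move=> i /negbTE ij; rewrite ffunE ij.
Qed.

Lemma Xm0 : Xm [ffun=> 0] = 1.
Proof. by rewrite /Xm big1 // => i _; rewrite ffunE. Qed.

Definition gw (v : seq nat) : H := \prod_(k <- v) g k.

Lemma gw_rcons v i : gw (rcons v i) = gw v * g i.
Proof. by rewrite /gw -cats1 big_cat big_seq1. Qed.

Lemma gw_beq v w : braid_eq n v w -> gw v = gw w.
Proof.
apply: beq_prod => [i j hi hj hij|i hi hj].
  by apply: (Hr_gcomm rels) => //; move: hi hj; rewrite /in_range; lia.
by apply: (Hr_braid rels); move: hi hj; rewrite /in_range; lia.
Qed.

Lemma gw_diag v f : all (in_range n) v -> exists f', gw v * diag one f = diag one f' * gw v.
Proof.
elim/last_ind: v f => [|v i IH] f; first by exists f; rewrite /gw big_nil mulr1 mul1r.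
rewrite all_rcons => /andP [hi hv].
have [f' hf] := IH (fun l => f (pact (sT n i) l)) hv.
exists f'; rewrite gw_rcons -mulrA (g_diag rels); last by move: hi; rewrite /in_range; lia.
by rewrite !mulrA hf.
Qed.

(** The parameter [P] admits first all words in the generators and later only normal forms. *)
Definition mono (P : seq nat -> bool) (x : H) : Prop :=
  exists alpha l v, P v /\ x = Xm alpha * one l * gw v.

Lemma mono_diag (P : seq nat -> bool) f x : (forall v, P v -> all (in_range n) v) ->
  mono P x -> lin (mono P) (x * diag one f).
Proof.
move=> PR [alpha [l [v [hv ->]]]].
have [f' hf] := gw_diag f (PR _ hv).
rewrite -(mulrA _ (gw v)) hf mulrA -(mulrA (Xm _)) (one_diag rels) -scalerAr -scalerAl.
by apply/linZ/lin_gen; exists alpha, l, v.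
Qed.

Let N := lin (mono (all (in_range n))).

Lemma N_diag f x : N x -> N (x * diag one f).
Proof. by apply: lin_mulr => y; apply: mono_diag. Qed.

Lemma N_g i x : in_g i -> N x -> N (x * g i).
Proof.
move=> hi; apply: lin_mulr => y [alpha [l [v [hv ->]]]].
rewrite -(mulrA _ (gw v)) -gw_rcons; apply: lin_gen; exists alpha, l, (rcons v i); split=> //.
by rewrite all_rcons hv andbT /in_range; lia.
Qed.

Lemma N_ginv i x : in_g i -> N x -> N (x * ginv i).
Proof.
move=> hi hx; rewrite mulrBr -scalerAr.
by apply: linB; [apply: N_g | apply/linZ/N_diag].
Qed.

(** Induction on the word: moving X_j or its inverse past the last letter leaves some X_k or inverse
    after a shorter word, followed by g_i, its inverse or e_i, all of which preserve the span. Both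
    signs are carried together. *)
Lemma N_X j x : in_X j -> N x -> N (x * X j) /\ N (x * Xi j).
Proof.
suff mono_X y j' : mono (all (in_range n)) y -> in_X j' -> N (y * X j') /\ N (y * Xi j').
  by move=> hj hx; split; apply: lin_mulr hx => y /mono_X /(_ hj) [].
move=> [alpha [l [v [hv ->]]]]; elim/last_ind: v j' hv => [|v i IH] [//|j'] hv hj.
  have hj' : (j' < n)%N by lia.
  rewrite /gw big_nil mulr1 -diag_delta -2!mulrA -X_diag // -Xi_diag // !mulrA.
  rewrite (Xm_mul _ (Ordinal hj')) (Xm_mulV _ (Ordinal hj')) diag_delta.
  by split; apply: lin_gen; [exists (upd alpha (Ordinal hj') 1), l, [::] |
    exists (upd alpha (Ordinal hj') (-1)), l, [::]]; rewrite /gw big_nil mulr1.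
move: hv; rewrite all_rcons => /andP [hi hv]; rewrite gw_rcons mulrA.
set u := _ * gw v; have {}hi : in_g i by move: hi; rewrite /in_range; lia.
have {}IH k : in_X k -> N (u * X k) /\ N (u * Xi k) by move=> hk; apply: IH.
have [ji|ji] := eqVneq j'.+1 i.
  rewrite -!(mulrA u) ji gX_self // gXi_self // (mulrDr u) -(scalerAr _ u) !mulrA.
  have [|h1 h2] := IH i.+1; first by lia.
  have [|h3 h4] := IH i; first by lia.
  split; first exact: N_ginv.
  by apply: linD; [apply: N_g | apply/linZ/N_diag].
have [ji1|ji1] := eqVneq j'.+1 i.+1.
  rewrite -!(mulrA u) ji1 gX_next // gXi_next // (mulrDr u) -(scalerAr _ u) !mulrA.
  have [|h1 h2] := IH i.+1; first by lia.
  have [|h3 h4] := IH i; first by lia.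
  split; last exact: N_ginv.
  by apply: linD; [apply: N_g | apply/linZ/N_diag].
rewrite -!(mulrA u) gX_far // gXi_far // !mulrA.
by have [|h1 h2] := IH j'.+1 => //; split; apply: N_g.
Qed.

Lemma N1 : N 1.
Proof.
rewrite -(Hr_sum1 rels); apply: lin_sum => l; apply: lin_gen.
by exists [ffun=> 0], l, [::]; rewrite Xm0 mul1r /gw big_nil mulr1.
Qed.

Let N' := lin (mono (mem (nfs n.-1))).

(** If the normal form c absorbs the letter i, nothing is left to do. If c is braid equivalent to c'
    followed by i, then g_c g_i = g_c' + (q - q^-1) g_c e_i, and e_i is diagonal. *)
Lemma N'_g i x : (0 < n)%N -> in_g i -> N' x -> N' (x * g i).
Proof.
move=> n_gt0 hi; apply: lin_mulr => y [alpha [l [c [hc ->]]]].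
rewrite -(mulrA _ (gw c)) -gw_rcons -cats1.
have PR v : v \in nfs n.-1 -> all (in_range n) v by apply: nfs_range; lia.
case: (@nfs_step n n.-1 c i _ hc) => [||[c' hc' hb]|[c' hc' hb]]; try by lia.
  by rewrite (gw_beq hb); apply: lin_gen; exists alpha, l, c'.
have gc : gw c = gw c' * g i by rewrite (gw_beq hb) cats1 gw_rcons.
rewrite cats1 gw_rcons gc -(mulrA (gw c')) -expr2 (g_quad rels) // !mulrDr mulr1.
apply: linD; first by apply: lin_gen; exists alpha, l, c'.
rewrite -!scalerAr -(g_e rels) // (mulrA (gw c')) -gc mulrA.
by apply/linZ/mono_diag => //; exists alpha, l, c.
Qed.

Lemma N_N' x : (0 < n)%N -> N x -> N' x.
Proof.
move=> n_gt0; apply: lin_sub => y [alpha [l [v [hv ->]]]].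
elim/last_ind: v hv => [_|v i IH].
  apply: lin_gen; exists alpha, l, [::]; split=> //.
  rewrite /=; elim: n.-1 => // j IH; apply/mem_nfsS; exists [::], 0%N; split=> //.
rewrite all_rcons => /andP [hi hv]; rewrite gw_rcons mulrA.
by apply: N'_g => //; [move: hi; rewrite /in_range; lia | apply: IH].
Qed.

End Bernstein.

Lemma Hbasis_spans (A : comNzRingType) (r n : nat) (q qi : A) (H : algType A)
  (g : nat -> H) (one : lab n r -> H) (X1 X1i : H) (red : 'S_n -> seq nat) :
  (0 < n)%N -> H_presented q qi g one X1 X1i -> (forall w, reduced w (red w)) ->
  forall x : H, exists s c, x = \sum_(i <- s) c i *: Hbasis_elt g one X1 red i.
Proof.
move=> n_gt0 pres hred x; have [rels _] := pres.
apply: lin_family.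
have : lin (mono g one X1 (all (in_range n))) x.
  (* The elements that preserve the span under right multiplication form a subalgebra containing the
     generators, hence all of [H]; since 1 is in the span, so is x. *)
  pose P h := forall y, lin (mono g one X1 (all (in_range n))) y ->
    lin (mono g one X1 (all (in_range n))) (y * h).
  rewrite -[x]mul1r; apply: (H_presented_ind (P := P) pres) => //; rewrite /P.
  - by move=> y; rewrite mulr1.
  - by move=> h h' ih ih' y hy; rewrite mulrBr; apply: linB; [apply: ih | apply: ih'].
  - by move=> a h ih y hy; rewrite -scalerAr; apply/linZ/ih.
  - by move=> h h' ih ih' y hy; rewrite mulrA; apply/ih'/ih.
  - by move=> i hi y; apply: N_g.
  - by move=> l y hy; rewrite -diag_delta; apply: (N_diag rels).
  - by move=> y hy; have [] := N_X rels (j := 1) _ hy.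
  - by move=> y hy; have [] := N_X rels (j := 1) _ hy.
  - exact: N1 rels.
move/(N_N' rels n_gt0); apply: lin_sub => _ [alpha [l [c [hc ->]]]].
apply: lin_gen; exists (alpha, l, wprod n c) => /=; congr (_ * _).
rewrite -/(gw g _); apply: (gw_beq rels); apply: beq_sym.
by apply: (reduced_braid_nfs (w := wprod n c)) => // w; exists (red w).
Qed.

(** * Seminormal representations *)

Section PermutationIndexedMatrices.
Variables (F : fieldType) (n : nat).
(** Square matrices form a nonzero ring in sizes of the form d.+1, so n! is written as a
    successor. *)
Let d := #|'S_n|.-1.

Fact card_perm_prednK : #|'S_n| = d.+1.
Proof. by rewrite prednK // card_Sn fact_gt0. Qed.

Definition enc (u : 'S_n) : 'I_d.+1 := cast_ord card_perm_prednK (enum_rank u).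
Definition dec (i : 'I_d.+1) : 'S_n := enum_val (cast_ord (esym card_perm_prednK) i).
Lemma encK : cancel enc dec.
Proof. by move=> u; rewrite /dec /enc cast_ordK enum_rankK. Qed.
Lemma decK : cancel dec enc.
Proof. by move=> i; rewrite /dec /enc enum_valK cast_ordKV. Qed.

Definition bv (u : 'S_n) : 'cV[F]_d.+1 := delta_mx (enc u) 0.
Definition op (f : 'S_n -> 'cV[F]_d.+1) : 'M[F]_d.+1 := \matrix_(i, j) f (dec j) i 0.
Definition bvc (u : 'S_n) (x : 'cV[F]_d.+1) : F := x (enc u) 0.

Lemma opE f u : op f *m bv u = f u.
Proof.
apply/matrixP => i j; rewrite mxE (bigD1 (enc u)) //= !mxE encK !eqxx ord1 mulr1.
by rewrite big1 ?addr0 // => k /negbTE ku; rewrite !mxE ku mulr0.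
Qed.

Lemma bv_ext (M M' : 'M[F]_d.+1) : (forall u, M *m bv u = M' *m bv u) -> M = M'.
Proof.
have E (P : 'M[F]_d.+1) i j : P i j = (P *m bv (dec j)) i 0.
  rewrite mxE (bigD1 j) //= !mxE decK !eqxx mulr1.
  by rewrite big1 ?addr0 // => k /negbTE ku; rewrite !mxE decK ku mulr0.
by move=> e; apply/matrixP => i j; rewrite E e -E.
Qed.

Lemma opM (M M' : 'M[F]_d.+1) (x : 'cV[F]_d.+1) : (M * M') *m x = M *m (M' *m x).
Proof. by rewrite mulmxA. Qed.

Lemma op1 (x : 'cV[F]_d.+1) : (1 : 'M[F]_d.+1) *m x = x.
Proof. exact: mul1mx. Qed.

Lemma bvc_bv u u' : bvc u (bv u') = (u == u')%:R.
Proof. by rewrite /bvc mxE andbT (inj_eq (can_inj encK)). Qed.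

Lemma bvcD u x y : bvc u (x + y) = bvc u x + bvc u y.
Proof. by rewrite /bvc mxE. Qed.
Lemma bvcZ u a x : bvc u (a *: x) = a * bvc u x.
Proof. by rewrite /bvc mxE. Qed.
Lemma bvc_sum u I (s : seq I) (P : pred I) f :
  bvc u (\sum_(i <- s | P i) f i) = \sum_(i <- s | P i) bvc u (f i).
Proof. by rewrite /bvc summxE. Qed.

Lemma bv_sum x : x = \sum_u bvc u x *: bv u.
Proof.
apply/matrixP => i j; rewrite summxE (bigD1 (dec i)) //= /bvc /bv !mxE decK !eqxx ord1 mulr1.
rewrite big1 ?addr0 // => u /negbTE ui; rewrite !mxE.
by rewrite -{1}(decK i) (inj_eq (can_inj encK)) eq_sym ui mulr0.
Qed.
End PermutationIndexedMatrices.

(** * The representation attached to a point and a label *)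

Section SeminormalRep.
Variables (F : fieldType) (n r : nat) (q qi : F) (x : 'I_n -> F) (l0 : lab n r).
Hypothesis qqi : q * qi = 1.
Hypothesis x_inj : injective x.
Hypothesis x_q2 : forall i j, i != j -> qi * x j != q * x i.
Hypothesis x_neq0 : forall i, x i != 0.
Notation s_ := (sT n).
Notation in_g i := (1 <= i <= n.-1)%N.
Notation v := (bv F).

(* Position [k] of the point [x \o u]; only [k < n] is meaningful. *)
Definition pos (u : 'S_n) (k : nat) : F := if insub k is Some j then x (u j) else 0.
Definition lbl (u : 'S_n) (k : nat) : nat := if insub k is Some j then l0 (u j) else 0%N.
Definition llab (u : 'S_n) : lab n r := [ffun j => l0 (u j)].

(* [ca] is forced by [g_i X_i = X_(i+1) (g_i - (q - qi) e_i)]; the quadratic relation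
   only determines the product of the two values of [cc] on a transposed pair. *)
Definition ca (b : bool) (y1 y2 : F) : F := if b then (q - qi) * y2 / (y2 - y1) else 0.
Definition cc (b : bool) (y1 y2 : F) : F := if b then q - ca b y1 y2 else 1.

Definition Ga (i : nat) (u : 'S_n) : F := ca (lbl u i.-1 == lbl u i) (pos u i.-1) (pos u i).
Definition Gc (i : nat) (u : 'S_n) : F := cc (lbl u i.-1 == lbl u i) (pos u i.-1) (pos u i).

Definition Gop (i : nat) := op (fun u => Ga i u *: v u + Gc i u *: v (s_ i * u)%g).
Definition Oop (l : lab n r) := op (fun u => (llab u == l)%:R *: v u).
Definition Xop (k : nat) := op (fun u => pos u k *: v u).
Definition Xiop (k : nat) := op (fun u => (pos u k)^-1 *: v u).

Lemma posE u (j : 'I_n) : pos u j = x (u j).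
Proof. by rewrite /pos valK. Qed.
Lemma lblE u (j : 'I_n) : lbl u j = l0 (u j).
Proof. by rewrite /lbl valK. Qed.

Lemma sT_nat i k (hk : (k < n)%N) : in_g i ->
  exists2 j : 'I_n, s_ i (Ordinal hk) = j & val j = if k == i.-1 then i else if k == i then i.-1 else k.
Proof. by move=> hi; exists (s_ i (Ordinal hk)) => //; rewrite sT_val //; lia. Qed.

Lemma pos_lbl_sT i k u : in_g i -> (k < n)%N ->
  let k' := if k == i.-1 then i else if k == i then i.-1 else k in
  pos (s_ i * u)%g k = pos u k' /\ lbl (s_ i * u)%g k = lbl u k'.
Proof.
move=> hi hk; have [j sj jv] := sT_nat hk hi; rewrite /= -jv.
by have := posE (s_ i * u)%g (Ordinal hk); have := lblE (s_ i * u)%g (Ordinal hk);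
  rewrite permM sj -posE -lblE.
Qed.

Lemma pos_sTl i u : in_g i -> pos (s_ i * u)%g i.-1 = pos u i.
Proof. by move=> hi; have [|-> _] := @pos_lbl_sT i i.-1 u hi; [lia | rewrite eqxx]. Qed.
Lemma lbl_sTl i u : in_g i -> lbl (s_ i * u)%g i.-1 = lbl u i.
Proof. by move=> hi; have [|_ ->] := @pos_lbl_sT i i.-1 u hi; [lia | rewrite eqxx]. Qed.
Lemma pos_sTr i u : in_g i -> pos (s_ i * u)%g i = pos u i.-1.
Proof. move=> hi; have [|-> _] := @pos_lbl_sT i i u hi; first lia. by case: eqP => [|_]; [lia | rewrite eqxx]. Qed.
Lemma lbl_sTr i u : in_g i -> lbl (s_ i * u)%g i = lbl u i.-1.
Proof. move=> hi; have [|_ ->] := @pos_lbl_sT i i u hi; first lia. by case: eqP => [|_]; [lia | rewrite eqxx]. Qed.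
Lemma pos_sTn i k u : in_g i -> (k < n)%N -> k != i.-1 -> k != i -> pos (s_ i * u)%g k = pos u k.
Proof. by move=> hi hk /negbTE h1 /negbTE h2; have [-> _] := @pos_lbl_sT i k u hi hk; rewrite h1 h2. Qed.
Lemma lbl_sTn i k u : in_g i -> (k < n)%N -> k != i.-1 -> k != i -> lbl (s_ i * u)%g k = lbl u k.
Proof. by move=> hi hk /negbTE h1 /negbTE h2; have [_ ->] := @pos_lbl_sT i k u hi hk; rewrite h1 h2. Qed.

Lemma pos_inj u k k' : (k < n)%N -> (k' < n)%N -> k != k' -> pos u k - pos u k' != 0.
Proof.
move=> hk hk' kk'; rewrite (posE u (Ordinal hk)) (posE u (Ordinal hk')) subr_eq0.
by apply: contra kk' => /eqP/x_inj/perm_inj [->].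
Qed.

Lemma GopE i u : Gop i *m v u = Ga i u *: v u + Gc i u *: v (s_ i * u)%g.
Proof. exact: opE. Qed.

Lemma sTKu i (u : 'S_n) : (s_ i * (s_ i * u) = u)%g.
Proof. by rewrite mulgA sTK mul1g. Qed.

Lemma q_neq0 : q != 0.
Proof. by apply: contraTneq (oner_neq0 F) => q0; rewrite -qqi q0 mul0r eqxx. Qed.

Lemma qiE : qi = q^-1.
Proof. by apply: (mulfI q_neq0); rewrite qqi divff // q_neq0. Qed.

(** Only [v u] and [v (s_i u)] occur, with the entries at i-1 and i exchanged between them; the
    coefficients match as rational functions of q and two entries. *)
Lemma Gop_quad i u : in_g i ->
  Gop i *m (Gop i *m v u) = v u + ((q - qi) * (lbl u i.-1 == lbl u i)%:R) *: (Gop i *m v u).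
Proof.
move=> hi; rewrite GopE mulmxDr -!scalemxAr !GopE sTKu /Ga /Gc.
rewrite pos_sTl ?pos_sTr ?lbl_sTl ?lbl_sTr //.
have h12 : pos u i - pos u i.-1 != 0 by apply: pos_inj; lia.
have h21 : pos u i.-1 - pos u i != 0 by apply: pos_inj; lia.
rewrite eq_sym /ca /cc /ca; move: h12 h21 q_neq0; rewrite qiE.
move: (pos u i) (pos u i.-1) => y2 y1 h12 h21 q0.
by case: eqP => _; apply/matrixP => k j; rewrite !mxE /=; field; rewrite ?h12 ?h21 ?q0.
Qed.

Lemma Gop_braid i u : (1 <= i)%N -> (i.+1 <= n.-1)%N ->
  Gop i *m (Gop i.+1 *m (Gop i *m v u)) = Gop i.+1 *m (Gop i *m (Gop i.+1 *m v u)).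
Proof.
move=> hi hi1; have hg : in_g i by lia.
have hg1 : in_g i.+1 by lia.
do 4!(rewrite ?(GopE, mulmxDr) -?scalemxAr).
rewrite !sTKu.
(* The two longest words give the same permutation, so both sides involve the same basis vectors.
   What remains are rational identities in three entries, one for each pattern of equal labels. *)
have -> : (s_ i.+1 * (s_ i * (s_ i.+1 * u)) = s_ i * (s_ i.+1 * (s_ i * u)))%g.
  by rewrite !mulgA sT_braid // /in_range; lia.
have e1 : forall w, pos (s_ i * w)%g i.+1 = pos w i.+1 by move=> w; apply: pos_sTn => //; lia.
have e2 : forall w, lbl (s_ i * w)%g i.+1 = lbl w i.+1 by move=> w; apply: lbl_sTn => //; lia.
have e3 : forall w, pos (s_ i.+1 * w)%g i.-1 = pos w i.-1 by move=> w; apply: pos_sTn => //; lia.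
have e4 : forall w, lbl (s_ i.+1 * w)%g i.-1 = lbl w i.-1 by move=> w; apply: lbl_sTn => //; lia.
have f1 w : pos (s_ i.+1 * w)%g i = pos w i.+1 by rewrite -[i]/(i.+1.-1) pos_sTl.
have f2 w : lbl (s_ i.+1 * w)%g i = lbl w i.+1 by rewrite -[i]/(i.+1.-1) lbl_sTl.
rewrite /Ga /Gc /= !(f1, f2, pos_sTl, lbl_sTl, pos_sTr, lbl_sTr, e1, e2, e3, e4) //=.
have h12 : pos u i - pos u i.-1 != 0 by apply: pos_inj; lia.
have h21 : pos u i.-1 - pos u i != 0 by apply: pos_inj; lia.
have h13 : pos u i.+1 - pos u i.-1 != 0 by apply: pos_inj; lia.
have h31 : pos u i.-1 - pos u i.+1 != 0 by apply: pos_inj; lia.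
have h23 : pos u i.+1 - pos u i != 0 by apply: pos_inj; lia.
have h32 : pos u i - pos u i.+1 != 0 by apply: pos_inj; lia.
move: (pos u i.-1) (pos u i) (pos u i.+1) (lbl u i.-1) (lbl u i) (lbl u i.+1)
  h12 h21 h13 h31 h23 h32 q_neq0 => y1 y2 y3 l1 l2 l3 h12 h21 h13 h31 h23 h32 q0.
rewrite (eq_sym l2 l1) (eq_sym l3 l2) /ca /cc /ca qiE.
have [-> | n12] := eqVneq l1 l2; have [e23 | n23] := eqVneq l2 l3; rewrite -?e23 ?eqxx ?n12 ?(negbTE n12) ?(negbTE n23);
  try case: (l1 == l3); apply/matrixP => k j; rewrite !mxE /=; field;
  by rewrite ?h12 ?h21 ?h13 ?h31 ?h23 ?h32 ?q0.
Qed.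

Lemma Gop_comm i j u : in_g i -> in_g j -> ((i.+2 <= j) || (j.+2 <= i))%N ->
  Gop i *m (Gop j *m v u) = Gop j *m (Gop i *m v u).
Proof.
move=> hi hj hij.
do 3!(rewrite ?(GopE, mulmxDr) -?scalemxAr).
have -> : (s_ i * (s_ j * u) = s_ j * (s_ i * u))%g.
  by rewrite !mulgA sT_comm // /in_range; lia.
rewrite /Ga /Gc !(pos_sTn, lbl_sTn) //; try lia.
by rewrite !scalerDr !scalerA addrACA; congr (_ + _ + (_ + _)); congr (_ *: _); rewrite mulrC.
Qed.

Lemma llab_sT i u : llab (s_ i * u)%g = pact (s_ i) (llab u).
Proof. by apply/ffunP => j; rewrite pact_sTE !ffunE permM. Qed.

Lemma inW_llab i u : in_g i -> inW (llab u) (s_ i) = (lbl u i.-1 == lbl u i).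
Proof.
move=> hi.
have h1 : (i.-1 < n)%N by lia.
have h2 : (i < n)%N by lia.
rewrite (@inW_sT _ _ _ _ (Ordinal h1) (Ordinal h2)) //; last by lia.
by rewrite (lblE u (Ordinal h1)) (lblE u (Ordinal h2)) !ffunE.
Qed.

Lemma OopE l u : Oop l *m v u = (llab u == l)%:R *: v u.
Proof. exact: opE. Qed.
Lemma XopE k u : Xop k *m v u = pos u k *: v u.
Proof. exact: opE. Qed.
Lemma XiopE k u : Xiop k *m v u = (pos u k)^-1 *: v u.
Proof. exact: opE. Qed.

Lemma Gop_Oop i l u : in_g i ->
  Gop i *m (Oop l *m v u) = Oop (pact (s_ i) l) *m (Gop i *m v u).
Proof.
move=> hi; rewrite OopE GopE mulmxDr -!scalemxAr !OopE llab_sT GopE.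
rewrite (inj_eq (inv_inj (@pact_sTT n r i))) scalerDr !scalerA.
congr (_ *: _ + _ *: _); last by rewrite mulrC.
rewrite /Ga -inW_llab // /ca; case: ifP; last by rewrite mulr0 mul0r.
by move=> /eqP {2}<-; rewrite (inj_eq (inv_inj (@pact_sTT n r i))) mulrC.
Qed.

Lemma pos_neq0 u k : (k < n)%N -> pos u k != 0.
Proof. by move=> hk; rewrite (posE u (Ordinal hk)). Qed.

(** Positions count from 0, so [Xop k] represents X_(k+1) and this is g_i X_i g_i = X_(i+1). *)
Lemma Gop_X i u : in_g i -> Gop i *m (Xop i.-1 *m (Gop i *m v u)) = Xop i *m v u.
Proof.
move=> hi; rewrite GopE mulmxDr -!scalemxAr !XopE mulmxDr -!scalemxAr !GopE sTKu /Ga /Gc.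
rewrite pos_sTl ?pos_sTr ?lbl_sTl ?lbl_sTr //.
have h12 : pos u i - pos u i.-1 != 0 by apply: pos_inj; lia.
have h21 : pos u i.-1 - pos u i != 0 by apply: pos_inj; lia.
rewrite [lbl u i == _]eq_sym /ca /cc /ca; move: h12 h21 q_neq0; rewrite qiE.
move: (pos u i) (pos u i.-1) => y2 y1 h12 h21 q0.
by case: eqP => _; apply/matrixP => k j; rewrite !mxE /=; field; rewrite ?h12 ?h21 ?q0.
Qed.

Lemma Xop_comm k k' : Xop k * Xop k' = Xop k' * Xop k.
Proof.
apply: bv_ext => u.
by rewrite !opM !XopE -!scalemxAr !XopE !scalerA mulrC.
Qed.

Lemma Gop_X_ring i : in_g i -> Gop i * Xop i.-1 * Gop i = Xop i.
Proof. by move=> hi; apply: bv_ext => u; rewrite !opM Gop_X. Qed.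

Lemma seminormal_Hrels : (0 < n)%N -> Hrels q qi Gop Oop (Xop 0) (Xiop 0).
Proof.
move=> n_gt0; split.
- by move=> i j hi hj hij; apply: bv_ext => u; rewrite !opM Gop_comm.
- by move=> i hi hi1; apply: bv_ext => u; rewrite !opM Gop_braid.
- by move=> i l hi; apply: bv_ext => u; rewrite !opM Gop_Oop.
- apply: bv_ext => u; rewrite mulmx_suml op1 (bigD1 (llab u)) //= OopE eqxx scale1r.
  by rewrite big1 ?addr0 // => l /negbTE lu; rewrite OopE eq_sym lu scale0r.
- move=> l l'; apply: bv_ext => u; rewrite opM OopE -scalemxAr OopE scalerA.
  have [<-|ll'] := eqVneq l l'; first by rewrite OopE; case: eqP; rewrite ?mulr1 ?mulr0.
  by rewrite mul0mx; have [->|] := eqVneq (llab u) l'; rewrite ?mul0r ?scale0r // eq_sym (negbTE ll') mulr0 scale0r.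
- move=> i hi; apply: bv_ext => u; rewrite expr2 opM Gop_quad // mulmxDl op1.
  rewrite -scalerA; congr (_ + _); rewrite -scalemxAl; congr (_ *: _).
  rewrite mulmx_suml big_mkcond (bigD1 (llab u)) //= big1 ?addr0 => [|l /negbTE lu].
    by rewrite inW_llab //; case: eqP => _; rewrite ?scale0r // scale1r opM OopE eqxx scale1r.
  by case: ifP => // _; rewrite opM OopE eq_sym lu scale0r mulmx0.
- by split; apply: bv_ext => u; rewrite opM op1 ?XopE ?XiopE -scalemxAr ?XopE ?XiopE scalerA
    ?mulVf ?mulfV ?scale1r // pos_neq0.
(* Both sides are products of X_1 and X_2, which are diagonal. *)
- move=> hn; have e := @Gop_X_ring 1 hn.
  have -> : Gop 1 * Xop 0 * Gop 1 * Xop 0 = Xop 1 * Xop 0 by rewrite -e.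
  have -> : Xop 0 * Gop 1 * Xop 0 * Gop 1 = Xop 0 * Xop 1 by rewrite -e !mulrA.
  exact: Xop_comm.
- move=> i hi; apply: bv_ext => u; rewrite !opM XopE GopE -scalemxAr GopE mulmxDr -!scalemxAr !XopE.
  by rewrite pos_sTn ?scalerDr ?scalerA; [rewrite ![pos u 0 * _]mulrC | lia..].
- move=> l; apply: bv_ext => u; rewrite !opM XopE OopE -!scalemxAr OopE XopE.
  by rewrite !scalerA mulrC.
Qed.

Lemma Xs_seminormal k : (k < n)%N -> Xs Gop (Xop 0) k.+1 = Xop k.
Proof.
elim: k => [//|k IH] hk; rewrite -(@Gop_X_ring k.+1); last by lia.
by rewrite -IH //; lia.
Qed.

Definition opw (w : seq nat) : 'M[F]_(#|'S_n|.-1.+1) := \prod_(k <- w) Gop k.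

Lemma opw_cons i w (y : 'cV[F]_(#|'S_n|.-1.+1)) : opw (i :: w) *m y = Gop i *m (opw w *m y).
Proof. by rewrite /opw big_cons opM. Qed.

Lemma bvc_Gop u i (y : 'cV[F]_(#|'S_n|.-1.+1)) :
  bvc u (Gop i *m y) = Ga i u * bvc u y + Gc i (s_ i * u)%g * bvc (s_ i * u)%g y.
Proof.
rewrite {1}(bv_sum y) mulmx_sumr bvc_sum.
under eq_bigr => w _ do rewrite -scalemxAr GopE bvcZ bvcD !bvcZ !bvc_bv mulrDr.
rewrite big_split /=; congr (_ + _).
  rewrite (bigD1 u) //= eqxx mulr1 big1 ?addr0 => [|w /negbTE wu]; first by rewrite mulrC.
  by rewrite eq_sym wu !mulr0.
rewrite (bigD1 (s_ i * u)%g) //= sTKu eqxx mulr1 big1 ?addr0 => [|w /negbTE wu]; first by rewrite mulrC.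
rewrite (_ : (u == _) = false) ?mulr0 //; apply: contraFF wu => /eqP ->.
by rewrite sTKu eqxx.
Qed.

(* Expanding [opw w] only produces subwords of [w]. *)
Lemma bvc_opw w u : all (in_range n) w -> bvc u (opw w *m v 1%g) != 0 ->
  u = wprod n w \/ exists w', [/\ all (in_range n) w', wprod n w' = u & (size w' < size w)%N].
Proof.
elim: w u => [|i w IH] u.
  move=> _; rewrite /opw big_nil op1 bvc_bv; have [-> _|_] := eqVneq u 1%g; last by rewrite eqxx.
  by left; rewrite /wprod big_nil.
move=> /= /andP [hi hw]; rewrite opw_cons bvc_Gop.
have [z1|nz1 _] := eqVneq (bvc u (opw w *m v 1%g)) 0; last first.
  right; case: (IH u hw nz1) => [->|[w' [h1 h2 h3]]]; first by exists w.
  by exists w'; split=> //; apply: leq_trans h3 _.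
rewrite z1 mulr0 add0r => /eqP nz.
have {}nz : bvc (s_ i * u)%g (opw w *m v 1%g) != 0 by apply/eqP => z; apply: nz; rewrite z mulr0.
case: (IH _ hw nz) => [e|[w' [h1 h2 h3]]].
  by left; rewrite /wprod big_cons -/(wprod n w) -e sTKu.
by right; exists (i :: w'); split; rewrite /= ?hi // /wprod big_cons -/(wprod n w') h2 sTKu.
Qed.

(** For equal labels the coefficient is (q^-1 y2 - q y1) / (y2 - y1), whose numerator is nonzero by
    [x_q2]. *)
Lemma Gc_neq0 i u : in_g i -> Gc i u != 0.
Proof.
move=> hi; rewrite /Gc /cc /ca; case: (_ =P lbl u i) => _; last exact: oner_neq0.
have h12 : pos u i - pos u i.-1 != 0 by apply: pos_inj; lia.
have h1 : (i.-1 < n)%N by lia.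
have h2 : (i < n)%N by lia.
have : qi * pos u i != q * pos u i.-1.
  rewrite (posE u (Ordinal h1)) (posE u (Ordinal h2)); apply: x_q2.
  by rewrite (inj_eq perm_inj) -val_eqE /=; lia.
apply: contraNneq => /(congr1 ( *%R (pos u i - pos u i.-1))).
rewrite mulr0 mulrBr (mulrC _ (_ / _)) divfK // => /eqP; rewrite subr_eq0 => /eqP e.
rewrite -subr_eq0; apply/eqP.
have -> : qi * pos u i - q * pos u i.-1 =
  (pos u i - pos u i.-1) * q - (q - qi) * pos u i by ring.
by rewrite e subrr.
Qed.

(** The coordinate at u receives a multiple of the old coordinate at u and one of that at s_i u. The
    former vanishes, as otherwise u would have a word shorter than its reduced one; the latter is
    nonzero by induction and [Gc_neq0]. *)
Lemma bvc_opw_lead w u : (0 < n)%N -> reduced u w -> bvc u (opw w *m v 1%g) != 0.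
Proof.
move=> n_gt0; elim: w u => [|i w IH] u [/andP [hr /eqP hu] hmin].
  by rewrite -hu /opw !big_nil op1 bvc_bv eqxx oner_neq0.
move: hr => /= /andP [hi hw].
have hu' : (s_ i * u)%g = wprod n w by rewrite -hu big_cons sTKu.
have red' : reduced (s_ i * u)%g w.
  split=> [|w' /andP [hw' /eqP pw']]; first by rewrite /is_expr hu' -/(wprod n w) eqxx andbT.
  have := hmin (i :: w'); rewrite /is_expr /= hi hw' big_cons pw' sTKu eqxx => /(_ isT).
  by rewrite ltnS.
rewrite opw_cons bvc_Gop; have [->|nz] := eqVneq (bvc u (opw w *m v 1%g)) 0.
  by rewrite mulr0 add0r mulf_neq0 ?IH // Gc_neq0 //; lia.
have [w' [h1 h2 h3]] : exists w', [/\ all (in_range n) w', wprod n w' = u & (size w' <= size w)%N].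
  case: (bvc_opw hw nz) => [->|[w' [h1 h2 h3]]]; first by exists w.
  by exists w'; split=> //; apply: ltnW.
have := hmin w'; rewrite /is_expr -/(wprod n w') h2 eqxx andbT => /(_ h1) /=; lia.
Qed.
End SeminormalRep.

(** * Linear independence *)

Section LaurentMonomials.
Variables (K : fieldType).
Let F : fieldType := {fraction {poly K}}.
Definition fracC (a : K) : F := FracField.tofrac a%:P.
Definition fracX : F := FracField.tofrac 'X.

Lemma fracX_neq0 : fracX != 0.
Proof. by rewrite tofrac_eq0 polyX_eq0. Qed.

Lemma fracC_hom : is_ring_hom fracC.
Proof.
by split=> [|a b|a b]; rewrite /fracC ?rmorph1 // ?rmorphD // ?rmorphM.
Qed.

Lemma laurent_indep (T : eqType) (S : seq T) (E : T -> int) (k : T -> K) :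
  uniq S -> {in S &, injective E} -> \sum_(t <- S) fracC (k t) * fracX ^ E t = 0 ->
  forall t, t \in S -> k t = 0.
Proof.
move=> uS injE sum0.
(* Multiplying by the M-th power of the indeterminate makes all exponents nonnegative, and
   polynomial coefficients can be compared. *)
pose M : nat := (\sum_(t <- S) absz (E t))%N.
have EM t : t \in S -> E t + M%:Z = absz (E t + M%:Z).
  move=> tS; have : (absz (E t) <= M)%N by rewrite /M (big_rem t) //= leq_addr.
  lia.
have : FracField.tofrac (\sum_(t <- S) (k t)%:P * 'X^(absz (E t + M%:Z))) = 0 :> F.
  transitivity ((\sum_(t <- S) fracC (k t) * fracX ^ E t) * fracX ^ M%:Z);
    last by rewrite sum0 mul0r.
  rewrite rmorph_sum mulr_suml.
  rewrite [LHS]big_seq [RHS]big_seq; apply: eq_bigr => t tS.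
  rewrite rmorphM rmorphXn /= -mulrA -expfzDr ?fracX_neq0 // EM //.
move/eqP; rewrite tofrac_eq0 => /eqP p0 t tS.
have := congr1 (fun p : {poly K} => p`_(absz (E t + M%:Z))) p0.
rewrite coef0 coef_sum (bigD1_seq t) //= coefCM coefXn eqxx mulr1.
rewrite big_seq_cond big1 ?addr0 // => [] t' /andP [t'S tt'].
rewrite coefCM coefXn; case: eqP => [e|_]; last by rewrite mulr0.
suff e' : t = t' by rewrite e' eqxx in tt'.
by apply: injE => //; apply: (addIr M%:Z); rewrite (EM t) // (EM t') // e.
Qed.
End LaurentMonomials.

Lemma digits_eq0 (n N : nat) (a : 'I_n -> int) :
  (forall i, absz (a i) < N)%N -> \sum_(i < n) a i * (N ^ i)%N%:Z = 0 ->
  forall i, a i = 0.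
Proof.
elim: n a => [|n IH] a aN; first by move=> _ [].
rewrite big_ord_recl expn0 mulr1.
have -> : \sum_(i < n) a (lift ord0 i) * (N ^ lift ord0 i)%N%:Z =
    (\sum_(i < n) a (lift ord0 i) * (N ^ i)%N%:Z) * N%:Z.
  rewrite mulr_suml; apply: eq_bigr => i _.
  by rewrite lift0 expnS PoszM -mulrA [N%:Z * _]mulrC.
set b := \sum_(i < n) _ => e.
(* The lowest digit is a multiple of N smaller than N in absolute value. *)
have b0 : b = 0 by have := aN ord0; nia.
have a0 : a ord0 = 0 by rewrite b0 mul0r addr0 in e.
move=> i; case: (unliftP ord0 i) => [j ->|-> //].
by apply: (IH (fun j => a (lift ord0 j))) => // k; apply: aN.
Qed.

Lemma seq_argmax (T : eqType) (f : T -> nat) (s : seq T) (P : pred T) x : x \in s -> P x ->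
  exists2 y, (y \in s) && P y & forall z, z \in s -> P z -> (f z <= f y)%N.
Proof.
move=> xs Px; have ex : exists m, has (fun y => P y && (f y == m)) s.
  by exists (f x); apply/hasP; exists x; rewrite // Px eqxx.
have bd m : has (fun y => P y && (f y == m)) s -> (m <= \max_(y <- s) f y)%N.
  by case/hasP => y ys /andP [_ /eqP <-]; apply: leq_bigmax_seq.
case: (ex_maxnP ex bd) => m /hasP [y ys /andP [Py /eqP fy]] hmax.
exists y; rewrite ?ys // fy => z zs Pz; apply: hmax; apply/hasP; exists z => //.
by rewrite Pz eqxx.
Qed.

Lemma Xs_hom (A B : nzRingType) (n : nat) (f : A -> B) (g : nat -> A) (g' : nat -> B) (X1 : A) k :
  is_ring_hom f -> (forall i, (1 <= i <= n.-1)%N -> f (g i) = g' i) -> (k < n)%N ->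
  f (Xs g X1 k.+1) = Xs g' (f X1) k.+1.
Proof.
move=> [_ _ fM] fg; elim: k => [//|k IH] hk.
rewrite -[Xs g X1 k.+2]/(g k.+1 * Xs g X1 k.+1 * g k.+1) !fM fg ?IH //; lia.
Qed.

Lemma prod_hom (A B : nzRingType) (f : A -> B) I (s : seq I) (F : I -> A) :
  is_ring_hom f -> f (\prod_(i <- s) F i) = \prod_(i <- s) f (F i).
Proof. by move=> [f1 _ fM]; elim/big_rec2: _ => // i x y _ <-; rewrite fM. Qed.

(** * Operators diagonal in the permutation basis *)

Section DiagonalAction.
Variables (F : fieldType) (n : nat).
Implicit Types (M : 'M[F]_(#|'S_n|.-1.+1)) (d : 'S_n -> F).

Definition acts_diag M d := forall u, M *m bv F u = d u *: bv F u.

Lemma bvc_acts_diag M d u (y : 'cV[F]_(#|'S_n|.-1.+1)) :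
  acts_diag M d -> bvc u (M *m y) = d u * bvc u y.
Proof.
move=> h; rewrite {1}(bv_sum y) mulmx_sumr bvc_sum (bigD1 u) //= big1 ?addr0 => [|w /negbTE wu].
  by rewrite -scalemxAr h !bvcZ bvc_bv eqxx mulr1 mulrC.
by rewrite -scalemxAr h !bvcZ bvc_bv eq_sym wu !mulr0.
Qed.

Lemma acts_diag1 : acts_diag 1 (fun=> 1).
Proof. by move=> u; rewrite op1 scale1r. Qed.

Lemma acts_diagM M M' d d' : acts_diag M d -> acts_diag M' d' ->
  acts_diag (M * M') (fun u => d u * d' u).
Proof. by move=> h h' u; rewrite opM h' -scalemxAr h scalerA mulrC. Qed.

Lemma acts_diag_prod I (s : seq I) (M : I -> 'M[F]_(#|'S_n|.-1.+1)) (d : I -> 'S_n -> F) :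
  (forall i, acts_diag (M i) (d i)) ->
  acts_diag (\prod_(i <- s) M i) (fun u => \prod_(i <- s) d i u).
Proof.
move=> h; elim: s => [|i s IH] u; first by rewrite !big_nil acts_diag1.
by rewrite !big_cons (acts_diagM (h i) IH).
Qed.

Lemma acts_diagX M d k : acts_diag M d -> acts_diag (M ^+ k) (fun u => d u ^+ k).
Proof.
move=> h; elim: k => [|k IH] u; first by rewrite !expr0 acts_diag1.
by rewrite !exprS (acts_diagM h IH).
Qed.

Lemma acts_diagV M M' d : M' * M = 1 -> (forall u, d u != 0) ->
  acts_diag M d -> acts_diag M' (fun u => (d u)^-1).
Proof.
move=> MM d0 h u; apply: (scalerI (d0 u)); rewrite scalerA divff // scale1r.
by rewrite scalemxAr -h -opM MM op1.
Qed.

Lemma acts_diag_zpow (H : nzRingType) (f : H -> 'M[F]_(#|'S_n|.-1.+1)) (X X' : H) d a :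
  is_ring_hom f -> X * X' = 1 -> X' * X = 1 -> (forall u, d u != 0) ->
  acts_diag (f X) d -> acts_diag (f (zpow X a)) (fun u => d u ^ a).
Proof.
move=> [f1 fD fM] h1 h2 d0 hX.
have fX x k : f (x ^+ k) = f x ^+ k by elim: k => [|k IH]; rewrite ?f1 // !exprS fM IH.
have hX' : acts_diag (f X') (fun u => (d u)^-1) by apply: acts_diagV d0 hX; rewrite -fM h2.
case: a => k; rewrite /zpow fX; first exact: acts_diagX.
rewrite (uinvE h1 h2) => u; rewrite (acts_diagX _ hX') NegzE.
by rewrite exprVn -exprnN.
Qed.
End DiagonalAction.

Lemma Hbasis_free (A : comNzRingType) (K : fieldType) (emb : A -> K) (r n : nat) (q qi : A)
  (H : algType A) (g : nat -> H) (one : lab n r -> H) (X1 X1i : H) (red : 'S_n -> seq nat) :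
  is_ring_hom emb -> injective emb -> q * qi = 1 -> (0 < n)%N ->
  H_presented q qi g one X1 X1i -> (forall w, reduced w (red w)) ->
  forall (s : seq ({ffun 'I_n -> int} * lab n r * 'S_n)) (c : _ -> A), uniq s ->
    \sum_(i <- s) c i *: Hbasis_elt g one X1 red i = 0 -> forall i, i \in s -> c i = 0.
Proof.
move=> hemb emb_inj qqi n_gt0 [rels univ] hred s c us sum0 i is_.
apply/eqP/negPn/negP => ci.
(* Among the terms with nonzero coefficient, one with [ws] of maximal length is chosen; its
   coefficient will turn out to be zero. *)
have [[[a0 ls] ws] /andP [ms cms] mmax] :=
  seq_argmax (P := fun i => c i != 0) (fun i => size (red i.2)) is_ ci.
move=> {i is_ ci}.
(* Larger than the difference of any two exponents that occur, and at least 2, so that powers of N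
   are distinct. *)
pose N := ((\sum_(i <- s) \sum_j absz (i.1.1 j)).*2.+2)%N.
(* The indeterminate of this field is the transcendental z; the image of [A], including q, consists
   of constants. *)
pose F : fieldType := {fraction {poly K}}.
pose phi a : F := fracC (emb a).
have hphi : is_ring_hom phi.
  have [e1 eD eM] := hemb; have [f1 fD fM] := fracC_hom K.
  by split=> [|a b|a b]; rewrite /phi ?e1 ?eD ?eM ?f1 ?fD ?fM.
have [phi0 _] := is_ring_hom_sub hphi.
have [emb0 _] := is_ring_hom_sub hemb.
have [phi1 phiD phiM] := hphi.
pose x (j : 'I_n) : F := fracX K ^+ (N ^ j).
have xX (a b : nat) (k k' : K) : fracC k * fracX K ^+ a = fracC k' * fracX K ^+ b -> a <> b -> k = 0.
  move=> e ab; pose kk (t : bool) := if t then k else - k'.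
  apply: (@laurent_indep K _ [:: true; false] (fun t => if t then a%:Z else b%:Z) kk _ _ _ true) => //.
    by move=> [] [] _ _ //; case=> // /esym.
  rewrite big_cons big_seq1 /= -!exprnP e.
  have [_ _ fM] := fracC_hom K; have [_ fB] := is_ring_hom_sub (fracC_hom K).
  by rewrite -[- k']sub0r fB -mulrDl addrCA subrr addr0 (is_ring_hom_sub (fracC_hom K)).1 mul0r.
have Ninj (j k : 'I_n) : j != k -> (N ^ j)%N <> (N ^ k)%N.
  by move=> jk /(@expnI N isT) e; rewrite (ord_inj e) eqxx in jk.
have fc1 : fracC (1 : K) = 1 by have [] := fracC_hom K.
have x_inj : injective x.
  move=> j k e; apply/eqP/negPn/negP => /Ninj jk.
  have := xX _ _ 1 1 _ jk; rewrite fc1 !mul1r => /(_ e) /eqP; by rewrite oner_eq0.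
have x_neq0 j : x j != 0 by rewrite expf_neq0 // fracX_neq0.
have phi_qqi : phi q * phi qi = 1 by rewrite -phiM qqi.
have x_q2 j k : j != k -> phi qi * x k != phi q * x j.
  move=> /Ninj jk; apply/eqP => e.
  have z := xX _ _ _ _ e (not_eq_sym jk).
  have := oner_neq0 F; rewrite -phi_qqi {2}/phi z.
  by have [-> _] := is_ring_hom_sub (fracC_hom K); rewrite mulr0 eqxx.
(* Chosen so that the basis vector of [ws] carries the label [ls]. *)
pose l0 : lab n r := [ffun j => ls ((ws^-1)%g j)].
have llab_ws : llab l0 ws = ls by apply/ffunP => j; rewrite !ffunE permK.
have relsM := seminormal_Hrels (r := r) l0 phi_qqi x_inj x_neq0 n_gt0.
have [[f [[fring fZ] [fg fone fX _]]] _] := univ _ _ _ _ _ (Hrels_restr hphi relsM).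
have [f1 fD fM] := fring.
have [f0 _ fsum] := is_alg_hom_linear (conj fring fZ).
pose rho : H -> 'M[F]_(#|'S_n|.-1.+1) := f.
have rho_ring : is_ring_hom rho := fring.
pose mon (i : {ffun 'I_n -> int} * lab n r * 'S_n) u := \prod_(j < n) pos x u j ^ i.1.1 j.
have rhoE i u : bvc u (rho (Hbasis_elt g one X1 red i) *m bv F 1%g) =
    mon i u * (llab l0 u == i.1.2)%:R * bvc u (opw (phi q) (phi qi) x l0 (red i.2) *m bv F 1%g).
  case: i => [[al l] w]; rewrite /Hbasis_elt /=.
  have [_ _ rhoM] := rho_ring.
  rewrite !rhoM !opM !prod_hom //.
  have -> : \prod_(k <- red w) rho (g k) = opw (phi q) (phi qi) x l0 (red w).
    rewrite /opw big_seq [RHS]big_seq; apply: eq_bigr => k kw; apply: fg.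
    by have [/andP [/allP/(_ k kw) hk _] _] := hred w; lia.
  rewrite (bvc_acts_diag _ _ (d := mon (al, l, w))).
    rewrite -mulrA; congr (_ * _); rewrite /rho fone.
    by apply: (bvc_acts_diag _ _ (d := fun u' => (llab l0 u' == l)%:R)) => u'; apply: OopE.
  apply: acts_diag_prod => j.
  have hj : (1 <= j.+1 <= n)%N by rewrite /= ltn_ord.
  have [h1 h2] := X_Xi rels hj.
  apply: (acts_diag_zpow _ rho_ring h1 h2) => [u'|u']; first exact: pos_neq0.
  rewrite /rho (Xs_hom X1 fring fg) ?ltn_ord // fX (Xs_seminormal l0 phi_qqi x_inj) //.
  exact: XopE.
pose D := bvc ws (opw (phi q) (phi qi) x l0 (red ws) *m bv F 1%g).
have D0 : D != 0 by apply: bvc_opw_lead.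
have key : \sum_(i <- s) phi (c i) * bvc ws (rho (Hbasis_elt g one X1 red i) *m bv F 1%g) = 0.
  transitivity (bvc ws (rho 0 *m bv F 1%g)); last by rewrite /rho f0 mul0mx /bvc mxE.
  rewrite -sum0 /rho fsum mulmx_suml bvc_sum; apply: eq_bigr => k _.
  by rewrite fZ restr_scaleE -scalemxAl bvcZ.
pose S := [seq i <- s | (i.1.2 == ls) && (i.2 == ws)].
pose E (i : {ffun 'I_n -> int} * lab n r * 'S_n) : int := \sum_(j < n) i.1.1 j * (N ^ ws j)%N%:Z.
have monE k : mon k ws = fracX K ^ E k.
  rewrite /mon /E; elim/big_rec2: _ => [|j y1 y2 _ ->]; first by rewrite expr0z.
  rewrite expfzDr ?fracX_neq0 //; congr (_ * _).
  by rewrite posE /x [in LHS]exprnP exprz_exp mulrC.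
have sumS : \sum_(k <- S) fracC (emb (c k)) * fracX K ^ E k = 0.
  apply: (mulIf D0); rewrite mul0r -[RHS]key mulr_suml big_filter big_mkcond /=.
  rewrite big_seq [RHS]big_seq; apply: eq_bigr => k ks.
  rewrite rhoE llab_ws -/(phi _); case: ifP => [/andP [/eqP kl /eqP kw]|nk].
    by rewrite kl eqxx mulr1 kw monE mulrA.
  have [kl|_] := eqVneq ls k.1.2; last by rewrite mulr0 mul0r mulr0.
  have [ck|ck] := eqVneq (c k) 0; first by rewrite ck phi0 mul0r.
  rewrite [bvc _ _](_ : _ = 0) ?mulr0 //; apply/eqP/negPn/negP => nz.
  have [/andP [hr /eqP hp] _] := hred k.2.
  case: (bvc_opw hr nz) => [e|[w' [h1 h2 h3]]].
    by move: nk; rewrite -kl -(etrans e hp : ws = k.2) !eqxx.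
  have [_ hmin] := hred ws; have := hmin w'.
  rewrite /is_expr h1 -/(wprod n w') h2 eqxx => /(_ isT) hm.
  by have := leq_trans (leq_trans h3 (mmax _ ks ck)) hm; rewrite ltnn.
have injE : {in S &, injective E}.
  move=> [[al l] w] [[al' l'] w']; rewrite !mem_filter /=.
  move=> /andP [/andP [/eqP -> /eqP ->] ks] /andP [/andP [/eqP -> /eqP ->] ks'] e.
  suff -> : al = al' by [].
  apply/ffunP => j; apply/eqP; rewrite -subr_eq0 -(permK ws j); apply/eqP.
  have bound t m : t \in s -> (absz (t.1.1 m) <= \sum_(i <- s) \sum_j absz (i.1.1 j))%N.
    move=> ts; rewrite (big_rem t) //= (bigD1 m) //= -addnA; exact: leq_addr.
  apply: (@digits_eq0 n N (fun m => al ((ws^-1)%g m) - al' ((ws^-1)%g m))).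
    move=> m; move: (bound _ ((ws^-1)%g m) ks) (bound _ ((ws^-1)%g m) ks') => /=.
    by rewrite /N; move: (al _) (al' _) (\sum_(i <- s) _)%N => b b' B; lia.
  rewrite (reindex_inj (@perm_inj _ ws)) /=.
  under eq_bigr do rewrite permK mulrBl.
  by rewrite sumrB; apply/eqP; rewrite subr_eq0; apply/eqP.
have cm0 : emb (c (a0, ls, ws)) = 0.
  apply: (laurent_indep (filter_uniq _ us) injE sumS).
  by rewrite mem_filter !eqxx ms.
by move/negP: cms; apply; apply/eqP/emb_inj; rewrite cm0 emb0.
Qed.

Lemma cK_inj : injective cK.
Proof. by move=> a b e; apply: polyC_inj; apply/eqP; rewrite -tofrac_eq; apply/eqP. Qed.

Lemma cKX a k : cK (a ^+ k) = cK a ^+ k.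
Proof. by rewrite /cK -!rmorphXn. Qed.

Lemma cK1 : cK 1 = 1.
Proof. by rewrite /cK !rmorph1. Qed.

Lemma Kq_natr_neq0 k : (0 < k)%N -> k%:R != 0 :> Kq.
Proof.
move=> k_gt0; have -> : k%:R = cK k%:R by rewrite /cK !rmorph_nat.
by rewrite /cK tofrac_eq0 polyC_eq0 Num.Theory.pnatr_eq0 -lt0n.
Qed.

Lemma qK_neq0 : qK != 0.
Proof. by rewrite /qK tofrac_eq0 polyX_eq0. Qed.

Theorem theorem3p3 (r n : nat) (hr : (0 < r)%N) (hn : (0 < n)%N)
  (zeta : algC) (hzeta : r.-primitive_root zeta)
  (* A = Z[q,q^-1], realised as the subring of K generated by q, q^-1 *)
  (A : comNzRingType) (embA : A -> Kq) (hembA : is_ring_hom embA)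
  (embA_inj : injective embA)
  (embA_im : forall x : Kq, (exists a, embA a = x) <->
      subring_gen (fun y => y = qK \/ y = qK^-1) x)
  (* R = Z[1/r][q,q^-1,zeta], realised as the subring of K generated by
     1/r, q, q^-1, zeta *)
  (R : comNzRingType) (embR : R -> Kq) (hembR : is_ring_hom embR)
  (embR_inj : injective embR)
  (embR_im : forall x : Kq, (exists a, embR a = x) <->
      subring_gen (fun y => [\/ y = (r%:R)^-1, y = qK, y = qK^-1 | y = cK zeta]) x)
  (* the inclusion A -> R *)
  (phi : A -> R) (hphi : is_ring_hom phi) (phi_emb : forall a, embR (phi a) = embA a)
  (qA qiA : A) (hqA : embA qA = qK) (hqiA : embA qiA = qK^-1)
  (qR qiR invr : R) (hqR : embR qR = qK) (hqiR : embR qiR = qK^-1)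
  (hinvr : embR invr = (r%:R)^-1)
  (* the affine Yokonuma-Hecke algebra *)
  (Y : algType R) (t h : nat -> Y) (Y1 Y1i : Y)
  (hY : Y_presented r n qR qiR invr t h Y1 Y1i)
  (* the algebra H^_{r,n} over A *)
  (H : algType A) (g : nat -> H) (one : lab n r -> H) (X1 X1i : H)
  (hH : H_presented qA qiA g one X1 X1i)
  (* H^R = R (x)_A H *)
  (HR : algType R) (iota : H -> HR) (hHR : base_change phi iota) :
  (exists f : Y -> HR, is_alg_hom f /\ bijective f) /\
  (forall red : 'S_n -> seq nat, (forall w, reduced w (red w)) ->
     is_basis (Hbasis_elt g one X1 red)).
Proof.
have [embA0 _] := is_ring_hom_sub hembA.
have [embR0 embRB] := is_ring_hom_sub hembR.
have [embA1 _ embAM] := hembA.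
have [embR1 _ embRM] := hembR.
have embRX a k : embR (a ^+ k) = embR a ^+ k.
  by elim: k => [|k IH]; rewrite ?expr0 ?embR1 // !exprS embRM IH.
have embR_nat k : embR k%:R = k%:R.
  by elim: k => [|k IH] //; rewrite -!natr1; case: hembR => _ -> _; rewrite IH embR1.
split; last first.
  move=> red hred; split; first exact: Hbasis_spans hn hH hred.
  apply: (Hbasis_free hembA embA_inj _ hn hH hred).
  by apply: embA_inj; rewrite embAM hqA hqiA embA1 divff // qK_neq0.
have [z zE] : exists z, embR z = cK zeta.
  by apply/embR_im => P _ _ _ _; apply; constructor 4.
have zX k : embR (z ^+ k) = cK (zeta ^+ k) by rewrite embRX zE cKX.
have phiq : phi qA = qR by apply: embR_inj; rewrite phi_emb hqA hqR.
have phiqi : phi qiA = qiR by apply: embR_inj; rewrite phi_emb hqiA hqiR.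
rewrite -phiq -phiqi in hY.
apply: (affine_yokonuma_iso (z := z) hr _ _ _ hphi hY hH hHR).
- by apply: embR_inj; rewrite zX (prim_expr_order hzeta) cK1 embR1.
- move=> m a rm /(congr1 embR)/eqP; rewrite embRM embRB embR0 embR1 zX mulf_eq0 subr_eq0.
  case/orP => /eqP e; first by apply: embR_inj; rewrite e embR0.
  case/negP: rm; rewrite (prim_order_dvd hzeta); apply/eqP/cK_inj.
  by rewrite e cK1.
- by apply: embR_inj; rewrite embRM hinvr embR_nat embR1 mulVf // Kq_natr_neq0.
Qed.
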